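(* Let $d\ge1$ and $n\ge1$ be integers. The cubature formula $$\frac1{\sqrt{d+1}}\int_{\Omega_H}f(\mathbf t)\,d\mathbf t=\frac1{(d+1)n^d}\sum_{\mathbf j\in\mathbb{H}_n^*}c_{\mathbf j}^{(n)}f\big(\tfrac{\mathbf j}{(d+1)n}\big)$$ is exact (i.e. equality holds) for all $f\in\mathcal{T}_{2n-1}$, where $\mathcal{T}_m:=\mathrm{span}\{\phi_{\mathbf k}:\mathbf k\in\mathbb{H}_m^*\}$.
   Context: Let $\mathbb{R}_H^{d+1}=\{\mathbf t\in\mathbb{R}^{d+1}:t_1+\cdots+t_{d+1}=0\}$, equipped with $d$-dimensional Lebesgue (surface) measure $d\mathbf t$, and $$\Omega_H=\{\mathbf t\in\mathbb{R}_H^{d+1}:-1<t_i-t_j\le 1,\ 1\le i<j\le d+1\},$$ which has measure $\sqrt{d+1}$. Let $\mathbb{H}=\{\mathbf k\in\mathbb{Z}^{d+1}:k_1+\cdots+k_{d+1}=0,\ k_1\equiv k_2\equiv\cdots\equiv k_{d+1}\ (\mathrm{mod}\ d+1)\}$ and, for $\mathbf k\in\mathbb{H}$, $\phi_{\mathbf k}(\mathbf t)=e^{\frac{2\pi i}{d+1}\mathbf k\cdot\mathbf t}$. Define $$\mathbb{H}_n^*=\{\mathbf k\in\mathbb{H}:-n\le\tfrac{k_i-k_j}{d+1}\le n,\ 1\le i<j\le d+1\},\quad \mathbb{H}_n^\circ=\{\mathbf k\in\mathbb{H}:-n<\tfrac{k_i-k_j}{d+1}<n,\ 1\le i<j\le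 d+1\}.$$ For nonempty disjoint $I,J\subset\{1,\dots,d+1\}$ let $$B_{I,J}=\{\mathbf t\in\mathbb{R}_H^{d+1}:t_i>t_l>t_j=t_i-1\ \text{for all } i\in I,\ j\in J,\ l\notin I\cup J\}$$ (when $I\cup J=\{1,\dots,d+1\}$ the condition is just $t_j=t_i-1$ for all $i\in I$, $j\in J$). For $i,j\ge1$ with $i+j\le d+1$ let $\mathbb{H}_n^{i,j}$ be the set of $\mathbf k\in\mathbb{H}$ such that $\frac{\mathbf k}{(d+1)n}\in B_{I,J}$ for some disjoint $I,J$ with $|I|=i$, $|J|=j$; these sets are pairwise disjoint with union $\mathbb{H}_n^*\setminus\mathbb{H}_n^\circ$. The weights are $c_{\mathbf k}^{(n)}=1$ if $\mathbf k\in\mathbb{H}_n^\circ$ and $c_{\mathbf k}^{(n)}=1/\binom{i+j}{i}$ if $\mathbf k\in\mathbb{H}_n^{i,j}$. *)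

(* Defs.v *)
From HB Require Import structures.
From mathcomp Require Import all_boot all_order all_algebra.
From mathcomp Require Import all_classical all_reals all_analysis.
From mathcomp Require Import complex.

Set Implicit Arguments.
Unset Strict Implicit.
Unset Printing Implicit Defensive.

Import Order.TTheory GRing.Theory Num.Theory.
Import numFieldNormedType.Exports.

Local Open Scope classical_set_scope.
Local Open Scope ring_scope.

Section lebesgue_tuple.
Context {R : realType}.
Local Notation mR := (measurableTypeR R).

Section cons_measure.
Local Open Scope ereal_scope.
Variables (n : nat) (m : {sigma_finite_measure set (n.-tuple mR) -> \bar R}).

Definition cons_pair (p : mR * n.-tuple mR) : n.+1.-tuple mR :=
  [tuple of p.1 :: p.2].

Lemma measurable_cons_pair : measurable_fun [set: mR * n.-tuple mR] cons_pair.
Proof. exact: measurable_cons. Qed.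

Definition cons_measure : set (n.+1.-tuple mR) -> \bar R :=
  pushforward (lebesgue_measure \x m) cons_pair.

Let cons_measure0 : cons_measure set0 = 0.
Proof. by rewrite /cons_measure /pushforward preimage_set0 measure0. Qed.

Let cons_measure_ge0 A : 0 <= cons_measure A.
Proof. by apply: measure_ge0; exact: measurable_cons_pair. Qed.

Let cons_measure_sigma_additive : semi_sigma_additive cons_measure.
Proof.
by apply: measure_semi_sigma_additive; exact: measurable_cons_pair.
Qed.

HB.instance Definition _ := isMeasure.Build _ _ _
  cons_measure cons_measure0 cons_measure_ge0 cons_measure_sigma_additive.

Lemma cons_measureE (A : set mR) (B : set (n.-tuple mR)) :
  measurable A -> measurable B ->
  cons_measure [set t | A (thead t) /\ B [tuple of behead t]] =
  lebesgue_measure A * m B.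
Proof.
move=> mA mB; rewrite -product_measure1E//= /cons_measure /pushforward.
congr (_ _); apply/seteqP; split=> -[x t] /=; rewrite theadE; last first.
  by move=> [? ?]; split => //; rewrite (_ : [tuple of _] = t)//; exact: val_inj.
by move=> [? +]; rewrite (_ : [tuple of _] = t)//; exact: val_inj.
Qed.

Let cons_measure_sigma_finite : sigma_finite setT cons_measure.
Proof.
have /sigma_finiteP[F [TF ndF Foo]] := sigma_finiteT (@lebesgue_measure R).
have /sigma_finiteP[G [TG ndG Goo]] := sigma_finiteT m.
exists (fun k => [set t | F k (thead t) /\ G k [tuple of behead t]]).
  apply/seteqP; split=> // t _.
  have [i _ Fit] : (\bigcup_i F i) (thead t) by rewrite -TF.
  have [j _ Gjt] : (\bigcup_i G i) [tuple of behead t] by rewrite -TG.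
  exists (maxn i j) => //; split.
  - by move: Fit; exact/subsetPset/ndF/leq_maxl.
  - by move: Gjt; exact/subsetPset/ndG/leq_maxr.
move=> k; have [mF ?] := Foo k; have [mG ?] := Goo k; split.
  apply: measurableI; rewrite -[X in measurable X]setTI.
  - exact: (@measurable_tnth _ mR n.+1 ord0).
  - exact: (@measurable_behead _ mR n).
by rewrite cons_measureE// lte_mul_pinfty// ge0_fin_numE.
Qed.

HB.instance Definition _ := @Measure_isSigmaFinite.Build _ _ _
  cons_measure cons_measure_sigma_finite.

End cons_measure.

Fixpoint lebesgue_tuple (n : nat) :
    {sigma_finite_measure set (n.-tuple mR) -> \bar R} :=
  match n with
  | 0 => \d_([tuple] : 0.-tuple mR)
  | n'.+1 => cons_measure (lebesgue_tuple n')
  end.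

Lemma lebesgue_tuple_box (n : nat) (A : 'I_n -> set mR) :
  (forall i, measurable (A i)) ->
  lebesgue_tuple n [set t | forall i, A i (tnth t i)] =
  (\prod_(i < n) lebesgue_measure (A i))%E.
Proof.
elim: n A => [|n IHn] A mA.
  rewrite big_ord0 /= diracE mem_set// => -[//].
rewrite big_ord_recl -IHn//.
transitivity (cons_measure (lebesgue_tuple n) [set t | A ord0 (thead t) /\
    [set t | forall i, A (lift ord0 i) (tnth t i)] [tuple of behead t]]).
  congr (_ _); apply/seteqP; split=> t /= At.
    split=> [|i]; first exact: At.
    by have := At (lift ord0 i); rewrite [t in tnth t]tuple_eta tnthS.
  by move=> i; case: (unliftP ord0 i) => [j|] ->;
    [rewrite [t in tnth t]tuple_eta tnthS; apply At.2|exact: At.1].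
apply: cons_measureE => //.
rewrite [X in measurable X](_ : _ =
    \bigcap_(i in [set: 'I_n]) ((@tnth n mR)^~ i @^-1` A (lift ord0 i))).
  apply: fin_bigcap_measurable => // i _; rewrite -[X in measurable X]setTI.
  exact: measurable_tnth.
by apply/seteqP; split=> t /= At i; [move=> _|]; exact: At.
Qed.

End lebesgue_tuple.

Section span_measure.
Context {R : realType}.
Local Notation mR := (measurableTypeR R).
Variables (n N : nat) (B : 'M[R]_(n, N)).

Definition row_comb (x : n.-tuple mR) : N.-tuple R :=
  [tuple \sum_(i < n) (tnth x i : R) * B i j | j < N].

Lemma measurable_row_comb : measurable_fun [set: n.-tuple mR] row_comb.
Proof.
apply/measurable_fun_tnthP => j.
rewrite (_ : _ \o _ = fun x => \sum_(i < n) (tnth x i : R) * B i j).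
  apply: measurable_sum => i; apply: measurable_realfun.measurable_funM => //.
  exact: (@measurable_tnth _ mR n i).
by apply/funext => x /=; rewrite tnth_mktuple.
Qed.

Definition row_comb_measure : set (N.-tuple R) -> \bar R :=
  pushforward (lebesgue_tuple n) row_comb.

Let row_comb_measure0 : row_comb_measure set0 = 0%E.
Proof. by rewrite /row_comb_measure /pushforward preimage_set0 measure0. Qed.

Let row_comb_measure_ge0 A : (0 <= row_comb_measure A)%E.
Proof. by apply: measure_ge0; exact: measurable_row_comb. Qed.

Let row_comb_measure_sigma_additive : semi_sigma_additive row_comb_measure.
Proof.
by apply: measure_semi_sigma_additive; exact: measurable_row_comb.
Qed.

HB.instance Definition _ := isMeasure.Build _ _ _ row_comb_measure
  row_comb_measure0 row_comb_measure_ge0 row_comb_measure_sigma_additive.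

(* If the rows of B are free, this is the n-dimensional Lebesgue measure of the
   subspace V of R^N that they span, extended by 0 outside V: the square root of
   the Gram determinant is the n-volume of the parallelepiped spanned by the
   rows of B, so that the measure only depends on V. *)
Definition span_measure : {measure set (N.-tuple R) -> \bar R} :=
  mscale (NngNum (sqrtr_ge0 (\det (B *m B^T)))) row_comb_measure.

End span_measure.

Section hyperplane.
Variables (R : realType) (d : nat).
Implicit Types (t : d.+1.-tuple R) (k : d.+1.-tuple int).

Definition RH : set (d.+1.-tuple R) := [set t | \sum_(i < d.+1) tnth t i = 0].

(* The vectors e_i - e_(d+1), 1 <= i <= d. *)
Definition RH_basis : 'M[R]_(d, d.+1) :=
  \matrix_(i, j) ((j == widen_ord (leqnSn d) i)%:R - (j == ord_max)%:R).

Definition RH_measure : {measure set (d.+1.-tuple R) -> \bar R} :=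
  span_measure RH_basis.

Definition OmegaH : set (d.+1.-tuple R) :=
  [set t | RH t /\ forall i j : 'I_d.+1, (i < j)%N ->
    -1 < tnth t i - tnth t j <= 1].

Definition HH : set (d.+1.-tuple int) :=
  [set k | \sum_(i < d.+1) tnth k i = 0 /\
    forall i j : 'I_d.+1, (tnth k i = tnth k j %[mod d.+1])%Z].

Definition Hstar (n : nat) : set (d.+1.-tuple int) :=
  [set k | HH k /\ forall i j : 'I_d.+1, (i < j)%N ->
    - n%:Q <= (tnth k i - tnth k j)%:Q / d.+1%:Q <= n%:Q].

Definition Hcirc (n : nat) : set (d.+1.-tuple int) :=
  [set k | HH k /\ forall i j : 'I_d.+1, (i < j)%N ->
    - n%:Q < (tnth k i - tnth k j)%:Q / d.+1%:Q < n%:Q].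

Lemma finite_Hstar (n : nat) : finite_set (Hstar n).
Proof.
have le k i j : Hstar n k -> tnth k i - tnth k j <= (n * d.+1)%:Z.
  move=> [_ kn]; have d0 : (0 : rat) < d.+1%:Q by rewrite ltr0z.
  case: (ltngtP i j) => [ij|ji|/val_inj->]; last by rewrite subrr.
    have /andP[_] := kn _ _ ij.
    by rewrite ler_pdivrMr// -intrM ler_int PoszM.
  have /andP[+ _] := kn _ _ ji.
  by rewrite ler_pdivlMr// -!intrN -intrM ler_int mulNr lerNl opprB PoszM.
pose M := (d.+1 * (n * d.+1))%N.
have kM k i : Hstar n k -> `|tnth k i| <= M%:Z.
  move=> kn; have [[k0 _] _] := kn.
  have kE : \sum_(j < d.+1) (tnth k i - tnth k j) = tnth k i *+ d.+1.
    by rewrite sumrB k0 subr0 sumr_const card_ord.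
  have kE' : `|tnth k i| <= `|tnth k i| *+ d.+1.
    by rewrite mulrS lerDl mulrn_wge0.
  apply: (le_trans kE'); rewrite -normrMn -kE.
  apply: (le_trans (ler_norm_sum _ _ _)).
  apply: (@le_trans _ _ (\sum_(j < d.+1) (n * d.+1)%:Z)); last first.
    by rewrite sumr_const card_ord /M PoszM -mulr_natl natz.
  apply: ler_sum => j _; rewrite ler_norml le//= lerNl opprB le//.
pose g (u : {ffun 'I_d.+1 -> 'I_(M + M).+1}) : d.+1.-tuple int :=
  [tuple (u i : nat)%:Z - M%:Z | i < d.+1].
apply: (@sub_finite_set _ _ (g @` setT)); last exact: finite_image.
move=> k kn; exists [ffun i => inord (absz (tnth k i + M%:Z))] => //.
apply: eq_from_tnth => i; rewrite tnth_mktuple ffunE.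
have := kM k i kn; rewrite ler_norml => /andP[kl kr].
have kp : 0 <= tnth k i + M%:Z by rewrite -lerBlDr sub0r.
move: (tnth k i) kr kp {kl} => x kr kp.
rewrite inordK ?gez0_abs ?addrK// -ltz_nat gez0_abs// -addn1 !PoszD.
by rewrite ltzD1 lerD2r.
Qed.

Definition BIJ (I J : {set 'I_d.+1}) : set (d.+1.-tuple R) :=
  [set t | RH t /\ forall i j, i \in I -> j \in J ->
    tnth t j = tnth t i - 1 /\
    forall l, l \notin I :|: J -> tnth t j < tnth t l < tnth t i].

Definition node (n : nat) k : d.+1.-tuple R :=
  [tuple (tnth k i)%:~R / (d.+1%:R * n%:R) | i < d.+1].

Definition Hij (n i j : nat) : set (d.+1.-tuple int) :=
  [set k | HH k /\ exists I J : {set 'I_d.+1},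
    [/\ I != finset.set0, J != finset.set0 & I :&: J == finset.set0] /\
    [/\ #|I| = i, #|J| = j & BIJ I J (node n k)]].

(* The sets Hij n i j are pairwise disjoint and cover Hstar n minus Hcirc n, so
   that the pick below is unambiguous on Hstar n; the final 0 is a dummy value
   outside Hstar n. *)
Definition weight (n : nat) k : R :=
  if k \in Hcirc n then 1
  else if [pick ij : 'I_d.+2 * 'I_d.+2 | k \in Hij n ij.1 ij.2] is Some ij
  then 'C(ij.1 + ij.2, ij.1)%:R^-1
  else 0.

Definition expi (x : R) : R[i] := (cos x +i* sin x)%C.

Definition phi k t : R[i] :=
  expi (2 * pi / d.+1%:R * \sum_(i < d.+1) (tnth k i)%:~R * tnth t i).

(* Functions on the hyperplane are represented by functions on the whole space,
   of which only the values on RH are constrained. *)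
Definition trigpoly (m : nat) : set (d.+1.-tuple R -> R[i]) :=
  [set f | exists (s : seq (d.+1.-tuple int)) (a : d.+1.-tuple int -> R[i]),
    (forall k, k \in s -> Hstar m k) /\
    forall t, RH t -> f t = \sum_(k <- s) a k * phi k t].

End hyperplane.

Definition Cintegral {disp : measure_display} {T : measurableType disp}
    {R : realType} (mu : {measure set T -> \bar R}) (D : set T)
    (f : T -> R[i]) : R[i] :=
  (\int[mu]_(x in D) complex.Re (f x) +i* \int[mu]_(x in D) complex.Im (f x))%C.

(* Main.v *)
Require Import Defs.
From mathcomp Require Import all_boot all_order all_algebra.
From mathcomp Require Import all_classical all_reals all_analysis.
From mathcomp Require Import complex.
From mathcomp Require Import measurable_realfun zify ring lra.

Set Implicit Arguments.
Unset Strict Implicit.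
Unset Printing Implicit Defensive.

Import Order.TTheory GRing.Theory Num.Theory.

Local Open Scope classical_set_scope.
Local Open Scope ring_scope.

(** Both sides are linear in f, so it suffices to compare them on a character
    phi_k with k in H*_(2n-1), and there both sides are 1 if k = 0 and 0
    otherwise: each of them averages phi_k over a group, the left one over the
    torus R_H / A_d and the right one over its finite subgroup of points
    k / ((d+1) n), where A_d is the lattice of integer vectors with sum zero.

    Left side. In the coordinates t = (x, - sum x) the surface measure is
    sqrt(d+1) times Lebesgue measure on R^d, and the half-open set Omega_H
    becomes a set that contains exactly one point of each orbit of Z^d
    ([OmegaH_cover], [OmegaH_uniq], [tile_hexagon_coord]). The integral of a
    periodic function does not depend on the choice of such a set
    ([integral_tile]). Comparison with the unit cube gives the volume, and
    comparison with a translate of itself shows that translating the integrand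
    does not change its integral. A nontrivial character changes sign under
    some translation ([phi_half_period]), so that its integral vanishes
    ([Cintegral_phi]).

    Right side. A node is determined by k in H, and two nodes represent the same
    point of the torus if their k differ by an element of (d+1) n A_d. An interior node is alone
    in its class. On the boundary, let I and J be the sets of maximal and of
    minimal coordinates of k, which differ by exactly (d+1) n; the nodes of the
    class arise by choosing anew which |I| of the coordinates in I and J are
    the high ones. There are binomial(|I| + |J|, |I|) of them, all with the same
    weight, so that the weights in each class add up to 1 ([fibre_weight]). The
    right side is therefore a plain sum over the quotient of H by (d+1) n A_d,
    a group with (d+1) n^d elements ([sum_box]). Such a sum of a character is
    invariant under multiplication by each value of the character, hence
    vanishes unless the character is 1 at all nodes; for k in H*_(2n-1) this
    happens only if k = 0 ([node_phi_eq1]). *)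

(** * Integer translates of the fundamental domain *)

Lemma zero_sum_signs m (a : 'I_m -> int) i :
  \sum_j a j = 0 -> a i != 0 -> exists p q, 1 <= a p /\ a q <= -1.
Proof.
move=> a0 ai0; apply: contrapT => npq.
have [le0|ge0] : (forall p, a p <= 0) \/ (forall q, 0 <= a q).
  apply: contrapT => /not_orP[/existsNP[p ap] /existsNP[q aq]].
  by apply: npq; exists p, q; split; lia.
- have /eqP : \sum_j - a j = 0 by rewrite sumrN a0 oppr0.
  rewrite psumr_eq0 => [|j _]; last by rewrite oppr_ge0.
  by move=> /allP/(_ i (mem_index_enum i))/=; rewrite oppr_eq0 (negbTE ai0).
- move/eqP: a0; rewrite psumr_eq0//.
  by move=> /allP/(_ i (mem_index_enum i))/=; rewrite (negbTE ai0).
Qed.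

Definition tshift (V : nmodType) m (t : m.-tuple V) (v : 'I_m -> V) : m.-tuple V :=
  [tuple tnth t i + v i | i < m].

Lemma tnth_tshift (V : nmodType) m (t : m.-tuple V) v i :
  tnth (tshift t v) i = tnth t i + v i.
Proof. by rewrite tnth_mktuple. Qed.

(** A strict total order on the coordinates, by value and then by position. It
    is used to choose, among the fractional parts of t, the coordinates that
    are to be lowered by 1. The tie-break by position is what makes the result
    satisfy the half-open inequalities that define Omega_H. *)
Section rank.
Variables (R : realType) (m : nat) (y : 'I_m.+1 -> R).

Definition above (i j : 'I_m.+1) := (y i < y j) || (y i == y j) && (i < j)%N.

Definition rank i := #|[set j | above i j]|%SET.

Lemma above_trans i j k : above i j -> above j k -> above i k.
Proof.
rewrite /above => /orP[ij|/andP[/eqP-> ij]] /orP[jk|/andP[/eqP<- jk]].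
- by rewrite (lt_trans ij jk).
- by rewrite ij.
- by rewrite jk.
- by rewrite eqxx (ltn_trans ij jk) orbT.
Qed.

Lemma aboveF i : above i i = false.
Proof. by rewrite /above ltxx ltnn andbF. Qed.

Lemma above_total i j : i != j -> above i j || above j i.
Proof.
move=> ij; rewrite /above; case: (ltgtP (y i) (y j)) => //= _.
by rewrite -neq_ltn.
Qed.

Lemma rank_lt i j : above i j -> (rank j < rank i)%N.
Proof.
move=> ij; apply: proper_card; apply/properP; split.
  by apply/fintype.subsetP => k; rewrite !inE; exact: above_trans.
by exists j; rewrite !inE ?aboveF.
Qed.

Lemma above_rank i j : (rank i < rank j)%N -> above j i.
Proof.
have [->|/above_total/orP[/rank_lt|//]] := eqVneq i j; first by rewrite ltnn.
by move=> /ltnW; rewrite leqNgt => /negbTE->.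
Qed.

Lemma rank_bound i : (rank i < m.+1)%N.
Proof.
rewrite -[m.+1]card_ord; apply: proper_card; apply/properP.
by split; [exact/fintype.subsetP|exists i; rewrite ?inE ?aboveF].
Qed.

(** The ranks are a permutation of 0, ..., m. *)
Lemma sum_rank_lt p : (p <= m.+1)%N -> (\sum_(i < m.+1) (rank i < p) = p)%N.
Proof.
move=> pm; pose r i := Ordinal (rank_bound i).
have r_inj : injective r.
  move=> i j [ij]; apply/eqP; apply: contraT => /above_total.
  by case/orP => /rank_lt; rewrite ij ltnn.
rewrite -[RHS](card_ord p) -sum1_card.
rewrite (big_ord_widen m.+1 (fun=> 1%N) pm) [RHS](reindex_inj r_inj)/=.
by rewrite [RHS]big_mkcond; apply: eq_bigr => i _; case: ifP.
Qed.

End rank.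

Section tiling.
Variables (R : realType) (d : nat).
Implicit Types (t : d.+1.-tuple R) (a : 'I_d.+1 -> int).

Lemma RH_tshift t a : RH t -> \sum_i a i = 0 ->
  RH (tshift t (fun i => (a i)%:~R)).
Proof.
rewrite /RH/= => t0 a0.
under eq_bigr do rewrite tnth_tshift.
by rewrite big_split/= t0 add0r -rmorph_sum/= a0.
Qed.

(** A nonzero a has an entry at least 1 and an entry at most -1, so that
    translation by a changes one difference of coordinates by at least 2,
    whereas these differences lie in an interval of length 2 whose endpoints
    are not both admissible. *)
Lemma OmegaH_uniq t a : OmegaH t -> OmegaH (tshift t (fun i => (a i)%:~R)) ->
  \sum_i a i = 0 -> a =1 (fun=> 0).
Proof.
move=> [_ tO] [_ taO] a0 i; apply/eqP; apply: contraT => /(zero_sum_signs a0).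
move=> [p [q [ap aq]]].
have ap' : 1 <= (a p)%:~R :> R by rewrite ler1z.
have aq' : (a q)%:~R <= -1 :> R by rewrite -(@intrN _ 1%:Z) ler_int.
case: (ltngtP p q) => [pq|qp|/val_inj pq]; last by move: ap aq; rewrite pq; lia.
- by have := tO _ _ pq; have := taO _ _ pq; rewrite !tnth_tshift; lra.
- by have := tO _ _ qp; have := taO _ _ qp; rewrite !tnth_tshift; lra.
Qed.

(** The fractional parts y of t add up to an integer m between 0 and d+1.
    Lowering the m largest of them by 1 restores the sum zero and leaves all
    coordinates in a window of length 1. *)
Lemma OmegaH_cover t : RH t -> exists a, \sum_i a i = 0 /\
  OmegaH (tshift t (fun i => (a i)%:~R)).
Proof.
move=> t0; pose y i := tnth t i - (Num.floor (tnth t i))%:~R.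
have yI i : 0 <= y i < 1.
  have /andP[? ?] := floor_itv (tnth t i).
  by rewrite /y subr_ge0 ltrBlDl addrC -(intrD _ 1%Z) addrC; apply/andP.
have yE : \sum_i y i = (- \sum_i Num.floor (tnth t i))%:~R.
  by rewrite sumrB t0 sub0r rmorphN rmorph_sum.
have [m mE] : exists m : nat, - \sum_i Num.floor (tnth t i) = m%:Z.
  exists `|- \sum_i Num.floor (tnth t i)|%N; rewrite gez0_abs//.
  by rewrite -(ler_int R) -yE sumr_ge0// => i _; case/andP: (yI i).
have md : (m <= d.+1)%N.
  rewrite -(ler_nat R) [m%:R]pmulrn -mE -yE.
  rewrite -[d.+1 in leRHS]card_ord -sumr_const ler_sum// => i _.
  by case/andP: (yI i) => _ /ltW.
exists (fun i => - Num.floor (tnth t i) - (rank y i < m)%N%:Z).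
have a0 : \sum_i (- Num.floor (tnth t i) - (rank y i < m)%N%:Z) = 0.
  by rewrite sumrB sumrN mE -(big_morph Posz PoszD erefl) sum_rank_lt// subrr.
split=> //; split; first exact: RH_tshift.
move=> i j ij; rewrite !tnth_tshift !intrB !intrN.
have := yI i; have := yI j; rewrite /y => /andP[j0 j1] /andP[i0 i1].
case: ltnP => im; case: ltnP => jm; rewrite /= ?mulr0z ?mulr1z.
- lra.
- have /orP[|/andP[_]] := above_rank (leq_trans im jm); last by lia.
  rewrite /y; lra.
- have /orP[|/andP[/eqP + _]] := above_rank (leq_trans jm im); rewrite /y; lra.
- lra.
Qed.

End tiling.

(** * Exponentials and periodicity *)

Section expi.
Variable R : realType.
Implicit Types x y : R.

Lemma expiD x y : expi (x + y) = expi x * expi y.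
Proof. by rewrite /expi cosD sinD [X in (_ +i* X)%C]addrC. Qed.

Lemma expi0 : expi (0 : R) = 1.
Proof. by rewrite /expi cos0 sin0. Qed.

Lemma expi_int (z : int) : expi (2 * pi * z%:~R : R) = 1.
Proof.
have expi_nat n : expi (2 * pi * n%:R : R) = 1.
  elim: n => [|n IHn]; first by rewrite mulr0 expi0.
  rewrite -(natr1 n) mulrDr mulr1 expiD IHn mul1r /expi.
  by rewrite mulr_natl -[pi *+ 2]add0r cosD2pi sinD2pi cos0 sin0.
case: z => n; first exact: expi_nat.
have := expiD (2 * pi * n.+1%:R) (2 * pi * (Negz n)%:~R).
by rewrite NegzE intrN mulrN subrr expi0 expi_nat mul1r.
Qed.

(** For y in (0, 1), cos (2 pi y) = 1 - 2 sin^2 (pi y) is less than 1. *)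
Lemma expi_eq1 y : expi (2 * pi * y) = 1 -> exists z : int, y = z%:~R.
Proof.
move=> y1; exists (Num.floor y); apply/eqP; rewrite -subr_eq0.
have /andP[y0 y2] := floor_itv y.
have : expi (2 * pi * (y - (Num.floor y)%:~R)) = 1.
  have := expiD (2 * pi * (y - (Num.floor y)%:~R)) (2 * pi * (Num.floor y)%:~R).
  by rewrite -mulrDr subrK y1 expi_int mulr1.
move: y0 y2; rewrite -subr_ge0 intrD -ltrBlDl.
move: (y - _) => u u0 u1; rewrite le_eqVlt eq_sym in u0.
case/predU1P : u0 => [->//|u0].
rewrite /expi => -[+ _]; rewrite (_ : 2 * pi * u = pi * u + pi * u); last by ring.
have := sin_gt0_pi (x := pi * u); rewrite mulr_gt0 ?pi_gt0//= gtr_pMr ?pi_gt0//.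
move=> /(_ u1) s0; rewrite cosD -!expr2 cos2sin2 => /eqP.
rewrite -subr_eq0 => s1; exfalso.
by have := exprn_gt0 2 s0; move: (sin _ ^+ 2) s1 => w /eqP; lra.
Qed.

End expi.

Section phi.
Variables (R : realType) (d : nat).
Implicit Types (t : d.+1.-tuple R) (k h : d.+1.-tuple int) (a : 'I_d.+1 -> int).

Lemma phi_tshift k t v : phi k (tshift t v) =
  phi k t * expi (2 * pi / d.+1%:R * \sum_i (tnth k i)%:~R * v i).
Proof.
rewrite /phi -expiD -mulrDr -big_split/=; congr (expi (_ * _)).
by apply: eq_bigr => i _; rewrite tnth_tshift mulrDr.
Qed.

Lemma HH_quot k : HH k -> forall j, exists q : 'I_d.+1 -> int,
  forall i, tnth k i = tnth k j + d.+1%:Z * q i.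
Proof.
move=> [_ k_mod] j.
exists (fun i => ((tnth k i %/ d.+1)%Z - (tnth k j %/ d.+1)%Z)) => i.
rewrite {1}(divz_eq (tnth k i) d.+1) {1}(divz_eq (tnth k j) d.+1) (k_mod i j); ring.
Qed.

(** As the entries of k are congruent modulo d+1 and the entries of a add up to
    zero, k . a is divisible by d+1. *)
Lemma phi_periodic k t a : HH k -> \sum_i a i = 0 ->
  phi k (tshift t (fun i => (a i)%:~R)) = phi k t.
Proof.
move=> /HH_quot/(_ ord0)[q kq] a0; rewrite phi_tshift.
rewrite (_ : _ / _ * _ = 2 * pi * (\sum_i q i * a i)%:~R) ?expi_int ?mulr1//.
rewrite -!mulrA; do 2 congr (_ * _).
rewrite (_ : \sum_i _ = (\sum_i tnth k i * a i)%:~R); last first.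
  by rewrite rmorph_sum; apply: eq_bigr => i _; rewrite /= intrM.
under eq_bigr do rewrite kq mulrDl -mulrA.
rewrite big_split/= -!mulr_sumr a0 mulr0 add0r intrM.
by rewrite mulKf// pnatr_eq0.
Qed.

Lemma phi0 t : phi [tuple 0 | i < d.+1] t = 1.
Proof.
by rewrite /phi big1 ?mulr0 ?expi0// => i _; rewrite tnth_mktuple mul0r.
Qed.

End phi.

(** * Zero-sum vectors and the quotient lattice *)

Section hext.
Variables (V : zmodType) (d : nat).
Implicit Types (u : 'I_d -> V) (a b : 'I_d.+1 -> V).

(** The zero-sum vector whose coordinates other than the last one are u: this
    identifies V^d with the vectors of sum zero in V^(d+1). *)
Definition hext u (i : 'I_d.+1) : V :=
  if unlift ord_max i is Some j then u j else - \sum_j u j.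

Lemma hext_lift u j : hext u (lift ord_max j) = u j.
Proof. by rewrite /hext liftK. Qed.

Lemma hext_max u : hext u ord_max = - \sum_j u j.
Proof. by rewrite /hext unlift_none. Qed.

Lemma sum_hext u : \sum_i hext u i = 0.
Proof.
rewrite (bigD1_ord ord_max)//= hext_max.
by under eq_bigr do rewrite hext_lift; rewrite addNr.
Qed.

Lemma hext_eq a b : \sum_i a i = 0 -> \sum_i b i = 0 ->
  (forall j, a (lift ord_max j) = b (lift ord_max j)) -> a =1 b.
Proof.
move=> a0 b0 ab i; case: (unliftP ord_max i) => [j|] -> //.
move: a0 b0; rewrite !(bigD1_ord ord_max)//=.
under eq_bigr do rewrite ab.
by move=> a0 b0; apply: (@addIr _ (\sum_j b (lift ord_max j))); rewrite a0 b0.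
Qed.

End hext.

Section lattice.
Variables (d n : nat).
Hypotheses (d0 : (0 < d)%N) (n0 : (0 < n)%N).
Implicit Types (k h : d.+1.-tuple int) (a : 'I_d.+1 -> int).

(** Translating the index of a node by [coarse a] translates the node itself
    by a, see [node_coarse]. *)
Definition coarse a (i : 'I_d.+1) : int := (d.+1 * n)%N%:Z * a i.

Definition equivH k k' := exists2 a, \sum_i a i = 0 & k' = tshift k (coarse a).

Lemma HH_tshift k v : HH k -> \sum_i v i = 0 ->
  (forall i j, (v i = v j %[mod d.+1])%Z) -> HH (tshift k v).
Proof.
move=> [k0 kmod] v0 vmod; split=> [|i j].
  by under eq_bigr do rewrite tnth_tshift; rewrite big_split/= k0 add0r.
by rewrite !tnth_tshift -modzDm (kmod i j) (vmod i j) modzDm.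
Qed.

Lemma sum_coarse a : \sum_i a i = 0 -> \sum_i coarse a i = 0.
Proof. by move=> a0; rewrite -mulr_sumr a0 mulr0. Qed.

Lemma HH_coarse k a : HH k -> \sum_i a i = 0 -> HH (tshift k (coarse a)).
Proof.
move=> Hk a0; apply: HH_tshift => //; first exact: sum_coarse.
by move=> i j; rewrite /coarse PoszM -!mulrA !modzMr.
Qed.

(** Representatives of H modulo (d+1) n A_d: an element of H is given by its
    first d coordinates, which share a residue r modulo d+1 and have the form
    r + (d+1) q_j with arbitrary q_j, to be taken modulo n. *)
Definition box := ('I_d.+1 * {ffun 'I_d -> 'I_n})%type.

Lemma card_box : #|{: box}| = (d.+1 * n ^ d)%N.
Proof. by rewrite card_prod card_ffun !card_ord. Qed.

Definition box_point (b : box) : d.+1.-tuple int :=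
  [tuple hext (fun j : 'I_d => (b.1 : nat)%:Z + d.+1%:Z * (b.2 j : nat)%:Z) i
     | i < d.+1].

Lemma HH_box_point b : HH (box_point b).
Proof.
split=> [|i j]; first by under eq_bigr do rewrite tnth_mktuple; exact: sum_hext.
suff pmod l : (tnth (box_point b) l = (b.1 : nat)%:Z %[mod d.+1])%Z by rewrite !pmod.
rewrite tnth_mktuple; case: (unliftP ord_max l) => [j'|] ->.
  by rewrite hext_lift addrC mulrC modzMDl.
rewrite hext_max big_split/= sumr_const card_ord -mulr_sumr.
rewrite (_ : - _ = - ((b.1 : nat)%:Z + \sum_i (b.2 i : nat)%:Z) * d.+1%:Z +
  (b.1 : nat)%:Z); last first.
  by rewrite -mulr_natr natz intS; ring.
by rewrite modzMDl.
Qed.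

Lemma box_point_surj k : HH k -> exists b, equivH (box_point b) k.
Proof.
move=> Hk; have [k0 kmod] := Hk.
have r_lt : (`|(tnth k ord_max %% d.+1)%Z| < d.+1)%N.
  by rewrite -ltz_nat gez0_abs ?modz_ge0// ltz_mod.
pose q j := (tnth k (lift ord_max j) %/ d.+1)%Z.
have m_lt j : (`|(q j %% n)%Z| < n)%N.
  by rewrite -ltz_nat gez0_abs ?modz_ge0 ?ltz_mod//; lia.
pose a := hext (fun j => (q j %/ n)%Z).
have a0 : \sum_i a i = 0 by exact: sum_hext.
exists (Ordinal r_lt, [ffun j => Ordinal (m_lt j)]), a => //.
set b := (_, _).
have [p0 _] := HH_coarse (HH_box_point b) a0.
apply: eq_from_tnth; apply: hext_eq => // j.
rewrite tnth_tshift tnth_mktuple /coarse !hext_lift/= ffunE/=.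
rewrite !gez0_abs ?modz_ge0//; last by lia.
rewrite (kmod ord_max (lift ord_max j)) {1}(divz_eq (tnth k (lift ord_max j)) d.+1).
by rewrite -/(q j) [in LHS](divz_eq (q j) n) PoszM /a hext_lift; ring.
Qed.

Lemma digit_uniq (D r r' : nat) (x y : int) : (r < D)%N -> (r' < D)%N ->
  r%:Z + D%:Z * x = r'%:Z + D%:Z * y -> r = r' /\ x = y.
Proof.
move=> rD r'D /[dup] e /(congr1 (fun z => (z %% D)%Z)).
rewrite ![D%:Z * _]mulrC ![_%:Z + _]addrC !modzMDl !modz_small; [|lia..].
move=> [rr]; split=> //; move: e; rewrite rr => /addrI/mulfI; apply; lia.
Qed.

Lemma box_point_inj b b' k : equivH (box_point b) k -> equivH (box_point b') k ->
  b = b'.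
Proof.
case: b b' => [r m] [r' m'] [a a0 ->] [a' a'0].
move=> /(congr1 (fun t => tnth t _)) e.
have {e} e j : r = r' :> nat /\ (m j : nat)%:Z + n%:Z * a (lift ord_max j) =
    (m' j : nat)%:Z + n%:Z * a' (lift ord_max j).
  have := e (lift ord_max j).
  rewrite !tnth_tshift !tnth_mktuple !hext_lift /coarse/= PoszM.
  rewrite -!addrA -!mulrA -!mulrDr.
  by move=> /digit_uniq; apply.
(* The residue is read off a coordinate other than the last one, which exists
   as d is positive. *)
congr (_, _); first by apply/val_inj; case: (e (Ordinal d0)).
by apply/ffunP => j; apply/val_inj; have [_ /digit_uniq[]] := e j.
Qed.

End lattice.

(** * Extreme coordinates and weights *)

Section extreme.
Variables (R : realType) (d n : nat).
Hypotheses (n0 : (0 < n)%N).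
Implicit Types (k h : d.+1.-tuple int) (a : 'I_d.+1 -> int) (I J S : {set 'I_d.+1}).

Local Notation N := (d.+1 * n)%N%:Z.

Let N0 : 0 < N.
Proof. by rewrite ltz_nat muln_gt0. Qed.

Lemma Hstar_int k : Hstar n k <-> HH k /\ forall i j, tnth k i - tnth k j <= N.
Proof.
have D0 : (0 : rat) < d.+1%:Q by rewrite ltr0z.
split=> -[Hk kn]; split=> // i j; last first.
  move=> ij; rewrite ler_pdivrMr// ler_pdivlMr// -!intrN -!intrM !ler_int.
  by have := kn i j; have := kn j i; rewrite PoszM; nia.
case: (ltngtP i j) => [/kn|/kn|/val_inj ->]; last by rewrite subrr ltW.
- rewrite ler_pdivrMr// ler_pdivlMr// -!intrN -!intrM !ler_int PoszM; nia.
- rewrite ler_pdivrMr// ler_pdivlMr// -!intrN -!intrM !ler_int PoszM; nia.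
Qed.

Lemma Hcirc_int k : Hcirc n k <-> HH k /\ forall i j, tnth k i - tnth k j < N.
Proof.
have D0 : (0 : rat) < d.+1%:Q by rewrite ltr0z.
split=> -[Hk kn]; split=> // i j; last first.
  move=> ij; rewrite ltr_pdivrMr// ltr_pdivlMr// -!intrN -!intrM !ltr_int.
  by have := kn i j; have := kn j i; rewrite PoszM; nia.
case: (ltngtP i j) => [/kn|/kn|/val_inj ->]; last by rewrite subrr.
- rewrite ltr_pdivrMr// ltr_pdivlMr// -!intrN -!intrM !ltr_int PoszM; nia.
- rewrite ltr_pdivrMr// ltr_pdivlMr// -!intrN -!intrM !ltr_int PoszM; nia.
Qed.

Lemma tnth_node k i : tnth (node R n k) i = (tnth k i)%:~R / N%:~R.
Proof. by rewrite tnth_mktuple PoszM intrM. Qed.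

Lemma node_coarse k a : node R n (tshift k (coarse n a)) =
  tshift (node R n k) (fun i => (a i)%:~R).
Proof.
apply: eq_from_tnth => i; rewrite tnth_tshift !tnth_node tnth_tshift /coarse.
by rewrite intrD intrM mulrDl (mulrC N%:~R) mulfK// intr_eq0 gt_eqF.
Qed.

Lemma RH_node k : HH k -> RH (node R n k).
Proof.
move=> [k0 _]; rewrite /RH/=; under eq_bigr do rewrite tnth_node.
by rewrite -mulr_suml -rmorph_sum/= k0 mul0r.
Qed.

Lemma OmegaH_Hstar k : HH k -> OmegaH (node R n k) -> Hstar n k.
Proof.
move=> Hk [_ kO]; have N0R : 0 < N%:~R :> R by rewrite ltr0z.
apply/Hstar_int; split=> // i j.
case: (ltngtP i j) => [/kO|/kO|/val_inj ->]; last by rewrite subrr ltW.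
- rewrite !tnth_node -mulrBl ler_pdivrMr// mul1r -intrB ler_int; by case/andP.
- rewrite !tnth_node -mulrBl ltr_pdivlMr// mulN1r -intrB -intrN ltr_int.
  by case/andP => ? _; lia.
Qed.

(** For k in H: I and J are nonempty and disjoint, and the node of k lies in
    B_(I,J), a condition that involves only integers when it is multiplied by
    (d+1) n. *)
Definition extremes k I J := [/\ I != finset.set0, J != finset.set0,
  (I :&: J == finset.set0)%SET & forall i j, i \in I -> j \in J ->
  tnth k i = tnth k j + N /\
  forall l, l \notin (I :|: J)%SET -> tnth k j < tnth k l < tnth k i].

Lemma BIJ_int I J k : HH k ->
  BIJ I J (node R n k) <-> forall i j, i \in I -> j \in J ->
  tnth k i = tnth k j + N /\
  forall l, l \notin (I :|: J)%SET -> tnth k j < tnth k l < tnth k i.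
Proof.
move=> Hk; have N0R : 0 < N%:~R :> R by rewrite ltr0z.
have nodelt i j : (tnth (node R n k) i < tnth (node R n k) j) = (tnth k i < tnth k j).
  by rewrite !tnth_node ltr_pM2r ?invr_gt0// ltr_int.
have nodeeq i j : tnth (node R n k) j = tnth (node R n k) i - 1 <->
    tnth k i = tnth k j + N.
  rewrite !tnth_node; split=> [e|->]; last first.
    by rewrite intrD mulrDl divff ?gt_eqF// addrK.
  apply/eqP; rewrite -(eqr_int R) intrD; apply/eqP.
  apply: (@mulIf _ (N%:~R)^-1); first by rewrite invr_eq0 gt_eqF.
  by rewrite mulrDl divff ?gt_eqF// e subrK.
split=> [[_ B]|B].
- move=> i j iI jJ; have [/nodeeq e lt] := B i j iI jJ.
  by split=> // l /lt; rewrite !nodelt.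
- split=> [|i j iI jJ]; first exact: RH_node.
  by have [/nodeeq e lt] := B i j iI jJ; split=> // l /lt; rewrite !nodelt.
Qed.

(** Hence I and J are determined by k, and the weight is well defined. *)
Lemma extremes_argmax k I J : extremes k I J ->
  (I = [set l | [forall m, tnth k m <= tnth k l]] /\
   J = [set l | [forall m, tnth k l <= tnth k m]])%SET.
Proof.
move=> [/finset.set0Pn[i iI] /finset.set0Pn[j jJ] IJ0 B].
have disj l : l \in I -> l \in J -> False.
  by move=> lI lJ; move/eqP/setP/(_ l): IJ0; rewrite !inE lI lJ.
have [ij _] := B i j iI jJ.
have max l : tnth k l <= tnth k i ?= iff (l \in I).
  apply/leifP; case: ifPn => lI; first by have [-> _] := B l j lI jJ; rewrite ij.
  case: (boolP (l \in J)) => lJ; first by have [+ _] := B i l iI lJ; lia.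
  by have [_ /(_ l)] := B i j iI jJ; rewrite inE negb_or lI lJ => /(_ isT)/andP[].
have min l : tnth k j <= tnth k l ?= iff (l \in J).
  apply/leifP; case: ifPn => lJ.
    by have [+ _] := B i l iI lJ; rewrite ij => /addIr->.
  case: (boolP (l \in I)) => lI; first by have [+ _] := B l j lI jJ; lia.
  by have [_ /(_ l)] := B i j iI jJ; rewrite inE negb_or lI lJ => /(_ isT)/andP[].
split; apply/setP => l; rewrite inE.
- rewrite -(max l); apply/eqP/forallP => [->m|/(_ i) le]; first exact: max.
  by apply/eqP; rewrite eq_le max.
- rewrite -(min l); apply/eqP/forallP => [<-m|/(_ j) le]; first exact: min.
  by apply/eqP; rewrite eq_le le andbT min.
Qed.

Lemma extremes_exist k : Hstar n k -> ~ Hcirc n k -> exists I J, extremes k I J.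
Proof.
move=> /Hstar_int[Hk kN] kC.
have [i [j ij]] : exists i j, tnth k i = tnth k j + N.
  apply: contrapT => nij; apply: kC; apply/Hcirc_int; split=> // i j.
  rewrite lt_neqAle kN andbT; apply/eqP => e; apply: nij; exists i, j; lia.
exists [set l | tnth k l == tnth k i]%SET, [set l | tnth k l == tnth k j]%SET.
split.
- by apply/finset.set0Pn; exists i; rewrite inE.
- by apply/finset.set0Pn; exists j; rewrite inE.
- by apply/eqP/setP => l; rewrite !inE; lia.
- move=> i' j'; rewrite !inE => /eqP-> /eqP->; split=> // l.
  by rewrite !inE; have := kN l j; have := kN i l; lia.
Qed.

Lemma weight_circ k : Hcirc n k -> weight R n k = 1.
Proof. by move=> kC; rewrite /weight mem_set. Qed.

Lemma weight_extremes k I J : HH k -> extremes k I J ->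
  weight R n k = 'C(#|I| + #|J|, #|I|)%:R^-1.
Proof.
move=> Hk E; have [I0 J0 IJ B] := E; rewrite /weight.
have /finset.set0Pn[i iI] := I0; have /finset.set0Pn[j jJ] := J0.
rewrite memNset; last first.
  by move=> /Hcirc_int[_ /(_ i j)]; have [-> _] := B i j iI jJ; lia.
case: pickP => [[p q]/=|/(_ (inord #|I|, inord #|J|))/=].
- move=> /set_mem[_ [I' [J' [[I'0 J'0 IJ'] [Ip Jq /(BIJ_int _ _ Hk) B']]]]].
  have [-> ->] := extremes_argmax E.
  rewrite -Ip -Jq.
  by have [-> ->] := @extremes_argmax k I' J' (And4 I'0 J'0 IJ' B').
- rewrite !inordK; [|by rewrite ltnS (leq_trans (max_card _))// card_ord ..].
  move=> /negP[].
  apply/mem_set; split=> //; exists I, J; split=> //; split=> //.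
  exact/BIJ_int.
Qed.

End extreme.

(** * Total weight of a class of nodes *)

Section fibre.
Variables (R : realType) (d n : nat).
Hypotheses (n0 : (0 < n)%N).
Implicit Types (k h : d.+1.-tuple int) (a : 'I_d.+1 -> int) (I J S : {set 'I_d.+1}).

Local Notation N := (d.+1 * n)%N%:Z.

Let N0 : 0 < N.
Proof. by rewrite ltz_nat muln_gt0. Qed.

(** Raising one coordinate and lowering another one stays within the bound N on
    differences only by exchanging a minimal with a maximal coordinate. *)
Lemma Hstar_translate k a p q : Hstar n k -> Hstar n (tshift k (coarse n a)) ->
  1 <= a p -> a q <= -1 -> [/\ a p = 1, a q = -1 & tnth k q = tnth k p + N].
Proof.
move=> /(Hstar_int n0)[_ kN] /(Hstar_int n0)[_ kaN] ap aq.
have := kaN p q; have := kN q p; rewrite !tnth_tshift /coarse => ? ?.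
have apq : a p - a q <= 2.
  rewrite -(ler_pM2l N0) mulrBr; lra.
have [ap1 aq1] : a p = 1 /\ a q = -1 by lia.
split=> //; move: (kN q p) (kaN p q); rewrite !tnth_tshift /coarse ap1 aq1; lra.
Qed.

(** The translation that makes S instead of I the set of high coordinates. *)
Definition exchange I S (i : 'I_d.+1) : int := (i \in S)%:R - (i \in I)%:R.

Lemma sum_exchangeE I S : \sum_i exchange I S i = #|S|%:Z - #|I|%:Z.
Proof. by rewrite sumrB -!natr_sum -!big_mkcond/= !sum1_card !natz. Qed.

Lemma sum_exchange I S : #|S| = #|I| -> \sum_i exchange I S i = 0.
Proof. by move=> SI; rewrite sum_exchangeE SI subrr. Qed.

(** On I and J together, k takes only the values v and v + N, the latter
    exactly on I; after the translation it takes the latter exactly on S. *)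
Lemma extremes_exchange k I J S : extremes n k I J -> S \subset (I :|: J)%SET ->
  #|S| = #|I| ->
  extremes n (tshift k (coarse n (exchange I S))) S ((I :|: J) :\: S)%SET.
Proof.
move=> [I0 J0 IJ B] SIJ cSI.
have cIJ : #|(I :|: J)%SET| = (#|I| + #|J|)%N.
  by rewrite cardsU (eqP IJ) cards0 subn0.
have /finset.set0Pn[i0 i0I] := I0; have /finset.set0Pn[j0 j0J] := J0.
have disj l : l \in I -> l \in J -> False.
  by move=> lI lJ; move/eqP/setP/(_ l): IJ; rewrite !inE lI lJ.
have low i : i \in (I :|: J)%SET -> tnth k i = tnth k j0 + N * (i \in I)%:R.
  rewrite inE => /orP[iI|iJ]; first by have [-> _] := B i j0 iI j0J; rewrite iI mulr1.
  rewrite (_ : (i \in I) = false); last by apply/negP => /disj; apply.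
  by have [e _] := B i0 i i0I iJ; have [e' _] := B i0 j0 i0I j0J; lia.
have moved i : i \in (I :|: J)%SET ->
    tnth (tshift k (coarse n (exchange I S))) i = tnth k j0 + N * (i \in S)%:R.
  by move=> /low e; rewrite tnth_tshift e /coarse /exchange; ring.
split.
- by rewrite -card_gt0 cSI card_gt0.
- by rewrite -card_gt0 cardsD (finset.setIidPr SIJ) cIJ cSI addKn card_gt0.
- by rewrite finset.setIDA finset.setDIl finset.setDv finset.set0I.
- move=> i j iS; rewrite inE => /andP[jS jIJ].
  rewrite (moved j jIJ) (moved i) ?(fintype.subsetP SIJ)// iS (negbTE jS).
  rewrite mulr1 mulr0 addr0.
  split=> [//|l].
  rewrite !inE negb_or negb_and negbK => /andP[lS lIJ].
  have {}lIJ : l \notin (I :|: J)%SET by rewrite !inE; move: lIJ; rewrite (negbTE lS).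
  have [ij /(_ l lIJ)] := B i0 j0 i0I j0J.
  rewrite tnth_tshift /coarse /exchange (negbTE lS).
  move: lIJ; rewrite inE negb_or => /andP[/negbTE-> _].
  by rewrite subrr mulr0 addr0 -ij.
Qed.

(** By [Hstar_translate], the translation takes only the values 1 on J, -1 on I
    and 0, so that it is the exchange of I with the set S of those coordinates
    that are high afterwards. *)
Lemma fibre_exchange k I J k' : Hstar n k -> extremes n k I J ->
  Hstar n k' -> equivH n k k' ->
  exists S, [/\ S \subset (I :|: J)%SET, #|S| = #|I| &
    k' = tshift k (coarse n (exchange I S))].
Proof.
move=> Hk E Hk' [a a0 k'E]; have [IE JE] := extremes_argmax n0 E.
have [_ kN] := (Hstar_int n0 k).1 Hk.
have aP i : [\/ a i = 0, a i = 1 /\ i \in J | a i = -1 /\ i \in I].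
  have [->|ai0] := eqVneq (a i) 0; first exact: Or31.
  have [p [q [ap aq]]] := zero_sum_signs a0 ai0.
  rewrite k'E in Hk'; case: (ltP 0 (a i)) => ai.
    have [-> _ e] := Hstar_translate Hk Hk' ai aq; apply: Or32; split=> //.
    by rewrite JE inE; apply/forallP => m; have := kN q m; lia.
  have {}ai : a i <= -1 by lia.
  have [_ -> e] := Hstar_translate Hk Hk' ap ai; apply: Or33; split=> //.
  by rewrite IE inE; apply/forallP => m; have := kN m p; lia.
have IJ i : i \in I -> i \in J -> False.
  by case: E => _ _ /eqP/setP/(_ i) + _; rewrite !inE => + iI iJ; rewrite iI iJ.
pose S := [set i | (i \in I)%:R + a i == 1]%SET.
have aS i : exchange I S i = a i.
  rewrite /exchange inE; case: (aP i) => [->|[-> iJ]|[-> iI]].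
  - by case: (i \in I).
  - by case: (boolP (i \in I)) => // /IJ/(_ iJ).
  - by rewrite iI.
exists S; split.
- apply/fintype.subsetP => i; rewrite !inE; case: (aP i) => [->|[_ ->]|[_ ->]] //.
    by case: (i \in I).
  by rewrite orbT.
- by apply/eqP; rewrite -eqz_nat -subr_eq0 -sum_exchangeE (eq_bigr a) ?a0.
- rewrite k'E; apply: eq_from_tnth => i; rewrite !tnth_tshift /coarse; congr (_ + _ * _).
  by rewrite aS.
Qed.

Lemma exchange_inj I k S S' :
  tshift k (coarse n (exchange I S)) = tshift k (coarse n (exchange I S')) -> S = S'.
Proof.
move=> e; apply/setP => i; move: e => /(congr1 (fun t => tnth t i)).
rewrite !tnth_tshift => /addrI/mulfI; rewrite gt_eqF// => /(_ isT)/addIr.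
by case: (i \in S); case: (i \in S').
Qed.

Lemma Hstar_extremes k I J : HH k -> extremes n k I J -> Hstar n k.
Proof.
move=> Hk E; have [IE JE] := extremes_argmax n0 E.
have [/finset.set0Pn[i iI] /finset.set0Pn[j jJ] _ /(_ i j iI jJ)[e _]] := E.
apply/(Hstar_int n0); split=> // p q.
by move: iI jJ; rewrite IE JE !inE => /forallP/(_ p) ? /forallP/(_ q) ?; lia.
Qed.

Lemma equivH_refl k : equivH n k k.
Proof.
exists (fun=> 0); first by rewrite big1.
by apply: eq_from_tnth => i; rewrite tnth_tshift /coarse mulr0 addr0.
Qed.

(** The weight of a node is the reciprocal of the number of nodes in its class:
    a class has one element if it contains an interior node, and otherwise its
    elements correspond to the subsets with |I| elements of I and J together. *)
Lemma fibre_weight k : Hstar n k ->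
  \sum_(k' \in Hstar n `&` [set k' | equivH n k k']) weight R n k' = 1.
Proof.
move=> Hk; have [kC|kC] := pselect (Hcirc n k).
  rewrite (_ : _ `&` _ = [set k]) ?fsbig_set1 ?weight_circ//.
  apply/seteqP; split=> [k' [Hk' [a a0 k'E]]|_ ->] /=; last first.
    by split=> //; exact: equivH_refl.
  rewrite k'E in Hk' *.
  have {}a0 i : a i = 0.
    apply/eqP; apply: contraT => /(zero_sum_signs a0)[p [q [ap aq]]].
    have [_ _ e] := Hstar_translate Hk Hk' ap aq.
    by move/(Hcirc_int n0) : kC => [_ /(_ q p)]; lia.
  by apply: eq_from_tnth => i; rewrite tnth_tshift /coarse a0 mulr0 addr0.
have [I [J E]] := extremes_exist n0 Hk kC.
have HHk : HH k by case: Hk.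
pose P := [set S : {set 'I_d.+1} | (S \subset (I :|: J)%SET) && (#|S| == #|I|)]%SET.
have cIJ : #|(I :|: J)%SET| = (#|I| + #|J|)%N.
  by case: E => _ _ /eqP IJ _; rewrite cardsU IJ cards0 subn0.
rewrite (reindex_fsbig (fun S => tshift k (coarse n (exchange I S))) [set` P]); last first.
  split.
  - move=> S /=; rewrite inE => /andP[SIJ /eqP cS]; split=> /=; last first.
      by exists (exchange I S) => //; exact: sum_exchange.
    apply: Hstar_extremes (extremes_exchange E SIJ cS).
    by apply: HH_coarse => //; exact: sum_exchange.
  - by move=> S S' _ _; exact: exchange_inj.
  - move=> k' [Hk' kk'].
    have [S [SIJ cS ->]] := fibre_exchange Hk E Hk' kk'.
    by exists S => //=; rewrite inE SIJ cS eqxx.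
rewrite (eq_fsbigr (fun=> 'C(#|I| + #|J|, #|I|)%:R^-1)); last first.
  move=> S; rewrite inE /= inE => /andP[SIJ /eqP cS].
  rewrite (weight_extremes R n0 (HH_coarse n HHk (sum_exchange cS))
    (extremes_exchange E SIJ cS)).
  by rewrite cardsD (finset.setIidPr SIJ) cIJ cS addKn.
rewrite -(@bigfs _ _ _ _ (index_enum _) (mem P)) ?index_enum_uniq//; last first.
  by move=> S _; rewrite mem_index_enum.
rewrite sumr_const cards_draws cIJ -[_^-1 *+ _]mulr_natr mulVf// pnatr_eq0 -lt0n.
by rewrite bin_gt0 leq_addr.
Qed.

End fibre.

(** * Discrete orthogonality *)

Section cubature.
Variables (R : realType) (d n : nat).
Hypotheses (d0 : (0 < d)%N) (n0 : (0 < n)%N).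
Implicit Types (k h m : d.+1.-tuple int) (a : 'I_d.+1 -> int).

Local Notation N := (d.+1 * n)%N%:Z.

Lemma equivH_transl k k' k'' : equivH n k k' -> equivH n k k'' <-> equivH n k' k''.
Proof.
move=> [a a0 ->]; split=> -[b b0 ->].
- exists (fun i => b i - a i); first by rewrite sumrB a0 b0 subrr.
  by apply: eq_from_tnth => i; rewrite !tnth_tshift /coarse; ring.
- exists (fun i => b i + a i); first by rewrite big_split/= a0 b0 addr0.
  by apply: eq_from_tnth => i; rewrite !tnth_tshift /coarse; ring.
Qed.

(** The class is nonempty because the translates of Omega_H cover R_H. *)
Lemma box_weight (b : box d n) :
  \sum_(k \in Hstar n `&` [set k | equivH n (box_point b) k]) weight R n k = 1.
Proof.
have Hb := HH_box_point b.
have [a [a0 bO]] := OmegaH_cover (RH_node R n Hb).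
rewrite -node_coarse// in bO.
have Hk := OmegaH_Hstar n0 (HH_coarse n Hb a0) bO.
rewrite -(fibre_weight R n0 Hk); apply: eq_fsbigl; congr (_ `&` _).
have bk : equivH n (box_point b) (tshift (box_point b) (coarse n a)) by exists a.
by apply/seteqP; split=> k /=; have [] := equivH_transl k bk.
Qed.

Lemma sum_box (g : d.+1.-tuple int -> R[i]) :
  (forall k a, HH k -> \sum_i a i = 0 -> g (tshift k (coarse n a)) = g k) ->
  \sum_(k \in Hstar n) (weight R n k)%:C%C * g k = \sum_(b : box d n) g (box_point b).
Proof.
move=> gper; have fH := finite_Hstar d n.
transitivity (\sum_(k <- finmap.enum_fset (fset_set (@Hstar d n))) \sum_(b : box d n)
    if k \in [set k | equivH n (box_point b) k] then (weight R n k)%:C%C * g k else 0).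
  rewrite fsbig_finite//; apply: eq_big_seq => k; rewrite in_fset_set// inE => Hk.
  have [b bk] : exists b : box d n, equivH n (box_point b) k.
    by apply: box_point_surj => //; case: Hk.
  rewrite -big_mkcond (big_pred1 b)// => b'.
  apply/idP/eqP => [/set_mem/(box_point_inj d0 n0 bk)->//|->]; exact/mem_set.
rewrite exchange_big; apply: eq_bigr => b _ /=.
rewrite -fsbig_finite// -fsbig_mkcondr -[RHS]mul1r.
transitivity (\sum_(k \in Hstar n `&` [set k | equivH n (box_point b) k])
    (weight R n k)%:C%C * g (box_point b)).
  apply: eq_fsbigr => k; rewrite inE => -[_ [a a0 ->]].
  by rewrite gper//; exact: HH_box_point.
rewrite -mulr_fsuml; congr (_ * _).
have fHb : finite_set (Hstar n `&` [set k | equivH n (box_point b) k]).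
  exact: finite_setIl.
by rewrite fsbig_finite// -rmorph_sum/= -fsbig_finite// box_weight.
Qed.

Definition node_phi m k : R[i] := phi m (node R n k).

Lemma node_phi_periodic m k a : HH m -> HH k -> \sum_i a i = 0 ->
  node_phi m (tshift k (coarse n a)) = node_phi m k.
Proof. by move=> Hm Hk a0; rewrite /node_phi node_coarse// phi_periodic. Qed.

Lemma node_phiD m k h : node_phi m (tshift k (tnth h)) = node_phi m k * node_phi m h.
Proof.
rewrite /node_phi (_ : node R n (tshift k _) = tshift (node R n k) (tnth (node R n h))).
  by rewrite phi_tshift.
by apply: eq_from_tnth => i; rewrite tnth_tshift !tnth_node tnth_tshift intrD mulrDl.
Qed.

(** Translation by h permutes the classes. *)
Lemma sum_box_translate m h : HH m -> HH h ->
  (\sum_(b : box d n) node_phi m (box_point b)) * node_phi m h =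
  \sum_(b : box d n) node_phi m (box_point b).
Proof.
move=> Hm [h0 hmod].
have HHh k : HH k -> HH (tshift k (tnth h)) by move=> Hk; exact: HH_tshift.
have /choice[r rP] (b : box d n) : exists b' : box d n,
    equivH n (box_point b') (tshift (box_point b) (tnth h)).
  by apply: box_point_surj => //; apply: HHh; exact: HH_box_point.
have r_inj : injective r.
  move=> b b' e; apply: (box_point_inj d0 n0 _ (equivH_refl n (box_point b'))).
  have [a a0 ea] := rP b; have [a' a'0 ea'] := rP b'; rewrite e in ea.
  exists (fun i => a' i - a i); first by rewrite sumrB a0 a'0 subrr.
  apply: eq_from_tnth => i; apply: (@addIr _ (tnth h i)).
  rewrite -tnth_tshift ea' !tnth_tshift.
  have := congr1 (fun t => tnth t i) ea; rewrite !tnth_tshift /coarse mulrBr.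
  by move=> e'; rewrite addrAC e'; ring.
rewrite [RHS](reindex_inj r_inj) mulr_suml; apply: eq_bigr => b _.
have [a a0 e] := rP b; rewrite -node_phiD e node_phi_periodic//.
exact: HH_box_point.
Qed.

(** Testing with h = (1, ..., 1) - (d+1) e_b shows that each m_b is a multiple
    N p_b of N = (d+1) n. The p_b add up to zero; if they are not all zero, two
    of them differ by at least 2, and then two entries of m differ by at least
    2 N, which is more than (d+1) (2n-1). *)
Lemma node_phi_eq1 m : Hstar (2 * n - 1)%N m ->
  (forall h, HH h -> node_phi m h = 1) -> m = [tuple 0 | i < d.+1].
Proof.
have n20 : (0 < 2 * n - 1)%N by lia.
move=> /(Hstar_int n20)[[m0 mmod] mN] m1.
have mq b : exists p : int, tnth m b = N * p.
  pose h := [tuple (1 - d.+1%:Z * (i == b)%:R) | i < d.+1].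
  have Hh : HH h.
    split=> [|i j].
      under eq_bigr do rewrite tnth_mktuple.
      rewrite sumrB sumr_const card_ord -mulr_sumr (bigD1 b)//= eqxx big1 ?addr0.
        by rewrite mulr1 natz subrr.
      by move=> i /negbTE->.
    by rewrite !tnth_mktuple ![1 - _]addrC -!mulrN ![d.+1%:Z * _]mulrC !modzMDl.
  have /= := m1 h Hh.
  rewrite /node_phi /phi.
  have -> : \sum_i (tnth m i)%:~R * tnth (node R n h) i = - (tnth m b)%:~R / n%:~R.
    under eq_bigr do rewrite tnth_node tnth_mktuple mulrA -intrM mulrBr mulr1.
    rewrite -mulr_suml -rmorph_sum/= sumrB m0 sub0r (bigD1 b)//= eqxx big1; last first.
      by move=> i /negbTE->; rewrite !mulr0.
    have D0 : d.+1%:~R != 0 :> R by rewrite intr_eq0.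
    rewrite mulr1 addr0 PoszM intrN !intrM invfM mulNr -mulrA (mulrCA d.+1%:~R).
    by rewrite mulKf// mulNr.
  move=> e.
  have [p ep] : exists p : int, - (tnth m b)%:~R / N%:~R = p%:~R :> R.
    apply: expi_eq1; rewrite -[RHS]e; congr expi.
    rewrite PoszM intrM invfM; ring.
  exists (- p); apply/eqP; rewrite -(eqr_int R) intrM intrN -ep mulNr opprK mulrC.
  by rewrite divfK// intr_eq0; lia.
apply: eq_from_tnth => i; rewrite tnth_mktuple.
have /choice[p pP] := mq.
have p0 : \sum_i p i = 0.
  apply: (@mulfI _ N); first by lia.
  by rewrite mulr0 mulr_sumr -[RHS]m0; apply: eq_bigr => j _; rewrite pP.
rewrite pP; apply/eqP; rewrite mulf_eq0; apply/orP; right.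
apply: contraT => /(zero_sum_signs p0)[q [q' [pq pq']]].
have := mN q q'; rewrite !pP -mulrBr PoszM -mulrA PoszM ler_pM2l//.
nia.
Qed.

Lemma cubature_phi m : Hstar (2 * n - 1)%N m ->
  \sum_(k \in Hstar n) (weight R n k)%:C%C * phi m (node R n k) =
  if m == [tuple 0 | i < d.+1] then d.+1%:R * n%:R ^+ d else 0.
Proof.
move=> Hm; have HHm : HH m by case: Hm.
rewrite (@sum_box (node_phi m)); last by move=> k a; exact: node_phi_periodic.
case: eqP => [->|/eqP mn0].
  under eq_bigr do rewrite /node_phi phi0.
  by rewrite sumr_const card_box natrM natrX.
apply/eqP; apply: contraNT mn0 => s0; apply/eqP; apply: node_phi_eq1 => // h Hh.
by apply: (mulfI s0); rewrite mulr1 sum_box_translate.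
Qed.

End cubature.

(** * Translation invariance of Lebesgue measure *)

Section lebesgue_translation.
Context {R : realType}.
Local Notation mR := (measurableTypeR R).

Lemma measurable_shift1 (c : R) :
  measurable_fun [set: mR] (fun x : mR => (x + c : mR)).
Proof. exact: measurable_funD. Qed.

Lemma lebesgue_measure_shift (c : R) (A : set mR) : measurable A ->
  lebesgue_measure ((fun x : mR => (x + c : mR)) @^-1` A) = lebesgue_measure A.
Proof.
move=> mA; apply/esym.
apply: (@lebesgue_measure_unique R
  (pushforward lebesgue_measure (fun x : mR => (x + c : mR)))) => //.
  exact: measurable_shift1.
move=> mc _ [[a b]] _ <-; rewrite /= /pushforward.
rewrite (_ : _ @^-1` _ = `]a - c, b - c]%classic); last first.
  by apply/seteqP; split=> x /=; rewrite !in_itv/= ltrBlDr lerBrDr.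
rewrite !lebesgue_measure_itv/= !lte_fin ltrD2r; case: ifP => // _.
by rewrite -!EFinB opprD addrACA subrr addr0.
Qed.

(** [tshift] on the measurable space of the Lebesgue measure. *)
Definition translate m (s : 'I_m -> R) (x : m.-tuple mR) : m.-tuple mR :=
  tshift x s.

Lemma measurable_translate m (s : 'I_m -> R) :
  measurable_fun [set: m.-tuple mR] (translate s).
Proof.
apply/measurable_fun_tnthP => i.
rewrite (_ : _ \o _ = fun x : m.-tuple mR => (tnth x i : R) + s i); last first.
  by apply/funext => x /=; rewrite tnth_tshift.
apply: measurable_funD => //.
exact: (@measurable_tnth _ mR m i).
Qed.

(** The product of translated measures agrees with the product measure on
    rectangles, so the claim follows by induction from the one-dimensional
    case. *)
Lemma lebesgue_tuple_translate m (s : 'I_m -> R) (A : set (m.-tuple mR)) :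
  measurable A ->
  lebesgue_tuple m (translate s @^-1` A) = lebesgue_tuple m A.
Proof.
elim: m s A => [|m IHm] s A mA.
  by congr (_ _); apply/seteqP; split=> t /=; rewrite (tuple0 (translate s t)) (tuple0 t).
pose s1 i := s (lift ord0 i).
pose sh (p : mR * m.-tuple mR) : mR * m.-tuple mR :=
  ((p.1 + s ord0 : mR), translate s1 p.2).
have msh : measurable_fun setT sh.
  apply/measurable_fun_pairP; split => /=.
    apply: (measurableT_comp (measurable_shift1 (s ord0))); exact: measurable_fst.
  apply: (measurableT_comp (measurable_translate _)); exact: measurable_snd.
have sh_inv X : measurable X -> (lebesgue_measure \x lebesgue_tuple m)%E X =
    (lebesgue_measure \x lebesgue_tuple m)%E (sh @^-1` X).
  apply: (@product_measure_unique _ _ _ _ _ lebesgue_measure (lebesgue_tuple m)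
    (pushforward (lebesgue_measure \x lebesgue_tuple m)%E sh)) => //.
  move=> B C mB mC; rewrite /= /pushforward.
  rewrite -(lebesgue_measure_shift (s ord0) mB) -(IHm s1 C mC).
  rewrite -product_measure1E//.
    rewrite -[X in measurable X]setTI; exact: measurable_shift1.
  rewrite -[X in measurable X]setTI; exact: measurable_translate.
rewrite /= /cons_measure /pushforward [RHS]sh_inv; last first.
  by rewrite -[X in measurable X]setTI; exact: measurable_cons_pair.
suff cons_sh p : translate s (cons_pair p) = cons_pair (sh p).
  by congr (_ _); apply/seteqP; split=> p /=; rewrite cons_sh.
apply: eq_from_tnth => i; rewrite tnth_tshift /cons_pair.
case: (unliftP ord0 i) => [j|] ->; last by rewrite !tnth0.
by rewrite !tnthS tnth_tshift.
Qed.

End lebesgue_translation.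

(** * Integrals of periodic functions over fundamental domains *)

Section lattice_tile.
Variables (R : realType) (m : nat).
Local Notation mR := (measurableTypeR R).
Local Notation mu := (@lebesgue_tuple R m).
Implicit Types (D : set (m.-tuple mR)) (f : m.-tuple mR -> \bar R) (s : 'I_m -> R).

Lemma translateNK s x : translate (fun i => - s i) (translate s x) = x.
Proof. by apply: eq_from_tnth => i; rewrite !tnth_tshift addrK. Qed.

Lemma translateC s s' x : translate s (translate s' x) = translate s' (translate s x).
Proof. by apply: eq_from_tnth => i; rewrite !tnth_tshift addrAC. Qed.

Lemma measurable_translate_preimage s D : measurable D -> measurable (translate s @^-1` D).
Proof. by move=> mD; rewrite -[X in measurable X]setTI; exact: measurable_translate. Qed.

Lemma integral_translate s D f : measurable D -> measurable_fun [set: m.-tuple mR] f ->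
  (forall x, 0 <= f x)%E ->
  (\int[mu]_(x in translate s @^-1` D) f (translate s x) = \int[mu]_(x in D) f x)%E.
Proof.
move=> mD mf f0.
rewrite -(ge0_integral_pushforward (measurable_translate s))//; last first.
  exact: measurable_funTS.
apply: eq_measure_integral => [|mt A mA _]; first exact: measurable_translate.
exact: lebesgue_tuple_translate.
Qed.

Definition zvec (a : {ffun 'I_m -> int}) (i : 'I_m) : R := (a i)%:~R.

(** Sets with exactly one point in each orbit of the lattice Z^m. *)
Definition tile D := forall x, exists! a, D (translate (zvec a) x).

Definition zperiodic T (f : m.-tuple mR -> T) :=
  forall a x, f (translate (zvec a) x) = f x.

(** Countable additivity over Z^m, enumerated by natural numbers; numbers that
    encode no lattice vector contribute the empty set. *)
Lemma ge0_integral_tile_split D (E : {ffun 'I_m -> int} -> set (m.-tuple mR)) f :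
  measurable D -> (forall a, measurable (E a)) -> measurable_fun [set: m.-tuple mR] f ->
  (forall x, 0 <= f x)%E -> (forall x, D x -> exists! a, E a x) ->
  (\int[mu]_(x in D) f x = \sum_(j <oo)
     \int[mu]_(x in if pickle_inv j is Some a then D `&` E a else set0) f x)%E.
Proof.
move=> mD mE mf f0 DE.
pose F j := if pickle_inv j is Some a then D `&` E a else set0.
have DF : D = \bigcup_j F j.
  apply/seteqP; split=> [x Dx|x [j _]]; last by rewrite /F; case: pickle_inv => // a [].
  have [a [Ex _]] := DE x Dx; exists (pickle a) => //.
  by rewrite /F pickleK_inv.
transitivity (\int[mu]_(x in \bigcup_j F j) f x)%E; first by rewrite -DF.
apply: ge0_integral_bigcup.
- by move=> j; rewrite /F; case: pickle_inv => // a; exact: measurableI.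
- exact: measurable_funTS.
- by [].
- move=> i j _ _ [x []]; rewrite /F.
  case Ei : pickle_inv => [a|//] [Dx Ea]; case Ej : pickle_inv => [b|//] [_ Eb].
  have [c [_ cu]] := DE x Dx.
  have := @pickle_invK {ffun 'I_m -> int} i; have := @pickle_invK {ffun 'I_m -> int} j.
  rewrite Ei Ej/= => <- <-.
  by rewrite -(cu _ Ea) -(cu _ Eb).
Qed.

(** Cut D1 along the translates of D2. The piece of D1 that a translation by a
    moves into D2 is carried onto the piece of D2 that the inverse translation
    moves into D1, and the pieces of the second kind make up D2. *)
Lemma integral_tile D1 D2 f : measurable D1 -> measurable D2 ->
  tile D1 -> tile D2 -> measurable_fun [set: m.-tuple mR] f -> (forall x, 0 <= f x)%E ->
  zperiodic f -> (\int[mu]_(x in D1) f x = \int[mu]_(x in D2) f x)%E.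
Proof.
move=> mD1 mD2 tD1 tD2 mf f0 fper.
pose E1 a := translate (zvec a) @^-1` D2.
pose E2 a := translate (fun i => - zvec a i) @^-1` D1.
have zvecN (a : {ffun 'I_m -> int}) x :
    translate (fun i => - zvec a i) x = translate (zvec [ffun i => - a i]) x.
  by apply: eq_from_tnth => i; rewrite !tnth_tshift /zvec ffunE intrN.
have negK (a : {ffun 'I_m -> int}) : [ffun i => - [ffun i => - a i] i] = a.
  by apply/ffunP => i; rewrite !ffunE opprK.
rewrite (@ge0_integral_tile_split D1 E1)//; last 2 first.
- by move=> a; exact: measurable_translate_preimage.
- by move=> x _; exact: tD2.
rewrite (@ge0_integral_tile_split D2 E2)//; last 2 first.
- by move=> a; exact: measurable_translate_preimage.
- move=> x _; have [a [aD au]] := tD1 x; exists [ffun i => - a i]; split.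
    by rewrite /E2/= zvecN negK.
  by move=> b; rewrite /E2/= zvecN => /au ->; rewrite negK.
apply: eq_eseriesr => j _; case: pickle_inv => [a|]; last by rewrite !integral_set0.
rewrite -[RHS](@integral_translate (zvec a))//; last first.
  by apply: measurableI => //; exact: measurable_translate_preimage.
rewrite (_ : _ @^-1` _ = D1 `&` E1 a).
  by apply: eq_integral => x _; rewrite fper.
by apply/seteqP; split=> x /=; rewrite /E2 /E1/= translateNK => -[].
Qed.

Lemma tile_translate D s : tile D -> tile (translate s @^-1` D).
Proof.
move=> tD x; have [a [Da au]] := tD (translate s x).
by exists a; split=> [|b] /=; rewrite translateC//; exact: au.
Qed.

(** A translate of D is again a tile. *)
Lemma integral_tile_translate D f s : measurable D -> tile D ->
  measurable_fun [set: m.-tuple mR] f -> (forall x, 0 <= f x)%E -> zperiodic f ->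
  (\int[mu]_(x in D) f (translate s x) = \int[mu]_(x in D) f x)%E.
Proof.
move=> mD tD mf f0 fper; pose s' i := - s i.
have -> : D = translate s @^-1` (translate s' @^-1` D).
  by apply/seteqP; split=> x /=; rewrite translateNK.
rewrite integral_translate//; last exact: measurable_translate_preimage.
rewrite (_ : translate s @^-1` _ = D).
  apply: integral_tile => //; first exact: measurable_translate_preimage.
  exact: tile_translate.
by apply/seteqP; split=> x /=; rewrite translateNK.
Qed.

Definition unit_cube : set (m.-tuple mR) :=
  [set t | forall i : 'I_m, `[0, 1[%classic (tnth t i)].

Lemma measurable_unit_cube : measurable unit_cube.
Proof.
rewrite (_ : unit_cube = \bigcap_(i in [set: 'I_m]) ((@tnth m mR)^~ i @^-1` `[0, 1[%classic)).
  apply: fin_bigcap_measurable => // i _; rewrite -[X in measurable X]setTI.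
  exact: measurable_tnth.
by apply/seteqP; split=> t /= At i; [move=> _|]; exact: At.
Qed.

Lemma tile_unit_cube : tile unit_cube.
Proof.
move=> x; exists [ffun i => - Num.floor (tnth x i : R)]; split.
  move=> i; rewrite /= tnth_tshift /zvec ffunE intrN in_itv/=.
  by have := floor_itv (tnth x i : R); rewrite intrD; lra.
move=> a aQ; apply/ffunP => i; rewrite ffunE; apply/oppr_inj; rewrite opprK.
apply: floor_def; have := aQ i; rewrite /= tnth_tshift /zvec in_itv/= => aQi.
by rewrite intrD intrN; lra.
Qed.

Lemma measure_unit_cube : mu unit_cube = 1%E.
Proof.
rewrite (lebesgue_tuple_box (A := fun=> `[0, 1[%classic))//.
by rewrite big1// => i _; rewrite lebesgue_measure_itv/= lte_fin ltr01 sube0.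
Qed.

Lemma measure_tile D : measurable D -> tile D -> mu D = 1%E.
Proof.
move=> mD tD.
have := integral_tile mD measurable_unit_cube tD tile_unit_cube (measurable_cst 1%E)
  (fun=> lee01) (fun _ _ => erefl).
rewrite /cst !integral_cst ?mul1e //; last exact: measurable_unit_cube.
by move=> ->; exact: measure_unit_cube.
Qed.

End lattice_tile.

(** * Coordinates on the hyperplane *)

Section hexagon.
Variables (R : realType) (d : nat).
Local Notation mR := (measurableTypeR R).
Local Notation mu := (@lebesgue_tuple R d).
Local Notation rc := (row_comb (RH_basis R d)).
Local Notation tupR := (d.+1.-tuple R).

Lemma widen_lift (i : 'I_d) : widen_ord (leqnSn d) i = lift ord_max i.
Proof. by apply/val_inj; rewrite -[RHS]/(nat_of_ord (lift ord_max i)) lift_max. Qed.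

Lemma RH_basis_lift i j : RH_basis R d i (lift ord_max j) = (j == i)%:R.
Proof.
by rewrite mxE widen_lift (inj_eq lift_inj) eq_sym [lift _ _ == _]eq_sym
  (negbTE (neq_lift _ _)) subr0.
Qed.

Lemma RH_basis_max i : RH_basis R d i ord_max = -1.
Proof. by rewrite mxE eqxx widen_lift (negbTE (neq_lift _ _)) sub0r. Qed.

Lemma tnth_rc x j : tnth (rc x) j = hext (tnth x) j.
Proof.
rewrite tnth_mktuple; case: (unliftP ord_max j) => [l|] ->.
  rewrite hext_lift (bigD1 l)//= RH_basis_lift eqxx mulr1 big1 ?addr0// => i il.
  by rewrite RH_basis_lift eq_sym (negbTE il) mulr0.
by rewrite hext_max -sumrN; apply: eq_bigr => i _; rewrite RH_basis_max mulrN1.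
Qed.

(** The Gram matrix is 1 + u u^T with u = (1, ..., 1)^T. Two block triangular
    factorizations of one matrix show that its determinant is that of the 1 x 1
    matrix 1 + u^T u. *)
Lemma det_gram : \det (RH_basis R d *m (RH_basis R d)^T) = d.+1%:R.
Proof.
pose u : 'cV[R]_d := const_mx 1.
have -> : RH_basis R d *m (RH_basis R d)^T = 1%:M + u *m u^T.
  have u1 (l : 'I_d) : u l ord0 = 1 by rewrite mxE.
  apply/matrixP => i j; rewrite mxE (bigD1_ord ord_max)//= [RHS]mxE [1%:M _ _]mxE.
  rewrite [(_ *m u^T) _ _]mxE big_ord1 [u^T _ _]mxE !u1 mulr1.
  rewrite [_^T _ _]mxE !RH_basis_max mulrNN mulr1 addrC; congr (_ + _).
  rewrite (bigD1 i)//= [_^T _ _]mxE !RH_basis_lift eqxx mul1r big1 ?addr0 // => l il.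
  by rewrite RH_basis_lift (negbTE il) mul0r.
have e1 : block_mx 1%:M u (- u^T) 1%:M =
    block_mx 1%:M 0 (- u^T) 1%:M *m block_mx 1%:M u 0 (1%:M + u^T *m u).
  by rewrite mulmx_block !mul1mx !mul0mx !mulmx1 !addr0 mulNmx addrC addrK.
have e2 : block_mx 1%:M u (- u^T) 1%:M =
    block_mx (1%:M + u *m u^T) u 0 1%:M *m block_mx 1%:M 0 (- u^T) 1%:M.
  by rewrite mulmx_block !mul1mx !mul0mx !mulmx0 !mulmx1 !add0r mulmxN addrK.
have := congr1 determinant (etrans (esym e1) e2).
rewrite !det_mulmx !det_lblock !det_ublock !det1 !mulr1 !mul1r => <-.
rewrite det_mx11 !mxE (eq_bigr (fun=> 1)) => [|i _]; last by rewrite !mxE mulr1.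
by rewrite sumr_const card_ord eqxx nat1r.
Qed.

Lemma measurable_dot (k : 'I_d.+1 -> R) :
  measurable_fun [set: tupR] (fun t : tupR => \sum_i k i * (tnth t i : R)).
Proof.
apply: measurable_sum => i; apply: measurable_funM => //.
exact: (@measurable_tnth _ R d.+1 i).
Qed.

Lemma measurable_OmegaH : measurable (@OmegaH R d : set tupR).
Proof.
have mtnth i : measurable_fun [set: tupR] (fun t : tupR => (tnth t i : R)).
  exact: (@measurable_tnth _ R d.+1 i).
rewrite (_ : @OmegaH R d = @RH R d `&` \bigcap_(ij in [set: 'I_d.+1 * 'I_d.+1])
   (if (ij.1 < ij.2)%N then
      (fun t : tupR => (tnth t ij.1 : R) - tnth t ij.2) @^-1` `]-1, 1]%classic
    else setT)); last first.
  apply/seteqP; split=> t /= [t0 tO]; split=> //.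
    by move=> [i j] _ /=; case: ifP => // ij; rewrite /= in_itv/=; exact: tO.
  move=> i j ij; have := tO (i, j) Logic.I; by rewrite /= ij /= in_itv.
apply: measurableI.
  rewrite (_ : @RH R d = (fun t : tupR => \sum_i (tnth t i : R)) @^-1` [set 0])//.
  rewrite -[X in measurable X]setTI.
  suff ms : measurable_fun [set: tupR] (fun t : tupR => \sum_i (tnth t i : R)) by exact: ms.
  exact: measurable_sum.
apply: fin_bigcap_measurable => // -[i j] _ /=; case: ifP => // _.
rewrite -[X in measurable X]setTI.
suff ms : measurable_fun [set: tupR] (fun t : tupR => (tnth t i : R) - tnth t j) by exact: ms.
exact: measurable_funB.
Qed.

(** Omega_H in the coordinates given by the chosen basis of R_H. *)
Definition hexagon_coord : set (d.-tuple mR) := rc @^-1` (@OmegaH R d).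

Lemma measurable_hexagon_coord : measurable hexagon_coord.
Proof.
rewrite -[X in measurable X]setTI; apply: (measurable_row_comb (RH_basis R d)) => //.
exact: measurable_OmegaH.
Qed.

Lemma RH_rc x : RH (rc x).
Proof. by rewrite /RH/=; under eq_bigr do rewrite tnth_rc; exact: sum_hext. Qed.

Lemma rc_translate s x : rc (translate s x) = tshift (rc x) (hext s).
Proof.
apply: eq_from_tnth; apply: hext_eq.
- exact: RH_rc.
- under eq_bigr do rewrite tnth_tshift.
  by rewrite big_split/= sum_hext addr0; exact: RH_rc.
- by move=> j; rewrite tnth_tshift !tnth_rc !hext_lift tnth_tshift.
Qed.

Lemma hext_zvec (a : {ffun 'I_d -> int}) :
  hext (zvec R a) =1 fun i => (hext a i)%:~R.
Proof.
move=> i; rewrite /hext; case: unlift => [j|]//.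
by rewrite rmorphN rmorph_sum.
Qed.

Lemma rc_zvec a x :
  rc (translate (zvec R a) x) = tshift (rc x) (fun i => (hext a i)%:~R).
Proof. by rewrite rc_translate; congr tshift; apply/funext/hext_zvec. Qed.

Lemma tile_hexagon_coord : tile hexagon_coord.
Proof.
move=> x; have [a [a0 aO]] := OmegaH_cover (RH_rc x).
have aE : hext [ffun j => a (lift ord_max j)] =1 a.
  apply: hext_eq => //; first exact: sum_hext.
  by move=> j; rewrite hext_lift ffunE.
exists [ffun j => a (lift ord_max j)]; split.
  rewrite /hexagon_coord/= rc_zvec (_ : tshift _ _ = tshift (rc x) (fun i => (a i)%:~R))//.
  by congr tshift; apply/funext => i; rewrite aE.
move=> b; rewrite /hexagon_coord/= rc_zvec => bO.
pose c i := hext b i - a i.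
have c0 : \sum_i c i = 0 by rewrite sumrB sum_hext a0 subrr.
have := OmegaH_uniq aO _ c0.
rewrite (_ : tshift (tshift _ _) _ = tshift (rc x) (fun i => (hext b i)%:~R)); last first.
  by apply: eq_from_tnth => i; rewrite !tnth_tshift /c intrB; lra.
move=> /(_ bO) ca; apply/ffunP => j; rewrite ffunE.
by have := ca (lift ord_max j); rewrite /c hext_lift => /subr0_eq.
Qed.

End hexagon.

(** * Continuous orthogonality *)

Section hexagon_integral.
Variables (R : realType) (d : nat).
Local Notation mR := (measurableTypeR R).
Local Notation mu := (@lebesgue_tuple R d).
Local Notation rc := (row_comb (RH_basis R d)).
Local Notation tupR := (d.+1.-tuple R).
Local Notation Omega := (@OmegaH R d : set tupR).
Local Notation nu := (RH_measure R d).
Local Notation mOmega := (@measurable_OmegaH R d).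

Lemma ge0_integral_RH (f : tupR -> \bar R) : measurable_fun [set: tupR] f ->
  (forall x, 0 <= f x)%E ->
  (\int[nu]_(t in Omega) f t =
   (Num.sqrt d.+1%:R)%:E * \int[mu]_(x in @hexagon_coord R d) f (rc x))%E.
Proof.
move=> mf f0.
rewrite /RH_measure /span_measure ge0_integral_mscale//; last 2 first.
- exact: mOmega.
- exact: measurable_funTS.
rewrite /= det_gram; congr (_ * _)%E.
rewrite -(ge0_integral_pushforward (measurable_row_comb (RH_basis R d)))//.
- exact: mOmega.
- exact: measurable_funTS.
Qed.

Lemma RH_measure_OmegaH : nu Omega = (Num.sqrt d.+1%:R)%:E.
Proof.
have := ge0_integral_RH (measurable_cst 1%E) (fun=> lee01).
rewrite /cst !integral_cst ?mul1e; [|exact: measurable_hexagon_coord|exact: mOmega].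
move=> ->; rewrite [X in (_ * X)%E](_ : _ = 1%E) ?mule1//.
by apply: measure_tile; [exact: measurable_hexagon_coord|exact: tile_hexagon_coord].
Qed.

Lemma bounded_integrable_OmegaH (h : tupR -> R) :
  measurable_fun [set: tupR] h -> (forall x, `|h x| <= 1) ->
  nu.-integrable Omega (EFin \o h).
Proof.
move=> mh h1; apply: measurable_bounded_integrable.
- exact: mOmega.
- by rewrite [X in (X < _)%E]RH_measure_OmegaH ltry.
- exact: measurable_funTS.
- exists 1; split; first exact: num_real.
  by move=> x x1 t _ /=; rewrite (le_trans (h1 t))// ltW.
Qed.

(** The integral of h equals that of its translate - h. The argument is run for
    the nonnegative functions 1 + h and 1 - h, to which [integral_tile_translate]
    applies. *)
Lemma Rintegral_RH_eq0 (h : tupR -> R) (s : 'I_d -> R) :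
  measurable_fun [set: tupR] h -> (forall t, `|h t| <= 1) ->
  (forall t a, \sum_i a i = 0 -> h (tshift t (fun i => (a i)%:~R)) = h t) ->
  (forall t, h (tshift t (hext s)) = - h t) ->
  \int[nu]_(t in Omega) h t = 0.
Proof.
move=> mh h1 hper hs.
have h_le t : -1 <= h t <= 1 by rewrite -ler_norml.
have mDh : measurable_fun [set: tupR] (fun t => (1 + h t)%:E).
  by apply/measurable_EFinP; exact: measurable_funD.
have mBh : measurable_fun [set: tupR] (fun t => (1 - h t)%:E).
  by apply/measurable_EFinP; exact: measurable_funB.
have DB : (\int[nu]_(t in Omega) (1 + h t)%:E = \int[nu]_(t in Omega) (1 - h t)%:E)%E.
  rewrite !ge0_integral_RH//; last 2 first.
  - by move=> x; rewrite lee_fin; have := h_le x; lra.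
  - by move=> x; rewrite lee_fin; have := h_le x; lra.
  congr (_ * _)%E.
  rewrite -(@integral_tile_translate R d _ (fun x => (1 + h (rc x))%:E) s).
  - by apply: eq_integral => x _; rewrite rc_translate hs.
  - exact: measurable_hexagon_coord.
  - exact: tile_hexagon_coord.
  - exact: (measurableT_comp mDh (measurable_row_comb (RH_basis R d))).
  - by move=> x; rewrite lee_fin; have := h_le (rc x); lra.
  - by move=> a x; rewrite rc_zvec hper// sum_hext.
have i1 : nu.-integrable Omega (EFin \o cst 1).
  by apply: bounded_integrable_OmegaH => // x; rewrite normr1.
have ih := bounded_integrable_OmegaH mh h1.
have : \int[nu]_(t in Omega) (1 + h t) = \int[nu]_(t in Omega) (1 - h t).
  by rewrite /Rintegral DB.
rewrite (@RintegralD _ _ _ _ _ (cst 1))//; last exact: mOmega.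
rewrite (@RintegralB _ _ _ _ _ (cst 1))//; last exact: mOmega.
move: (\int[_]_(_ in _) _) => c; move: (\int[_]_(_ in _) _) => x; lra.
Qed.

Definition angle (k : d.+1.-tuple int) (t : tupR) : R :=
  2 * pi / d.+1%:R * \sum_(i < d.+1) (tnth k i)%:~R * tnth t i.

Lemma measurable_angle k : measurable_fun [set: tupR] (angle k).
Proof. by apply: measurable_funM => //; exact: measurable_dot. Qed.

Lemma measurable_cos_angle k : measurable_fun [set: tupR] (cos \o angle k).
Proof.
apply: measurableT_comp (measurable_angle k).
exact: (continuous_measurable_fun (@continuous_cos R)).
Qed.

Lemma measurable_sin_angle k : measurable_fun [set: tupR] (sin \o angle k).
Proof.
apply: measurableT_comp (measurable_angle k).
exact: (continuous_measurable_fun (@continuous_sin R)).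
Qed.

(** If k is not zero, it has an entry k_j different from the last one, say by
    (d+1) q. Moving the coordinate x_j by 1 / (2 q) changes the angle by pi. *)
Lemma phi_half_period k : HH k -> k != [tuple 0 | i < d.+1] ->
  exists s : 'I_d -> R, forall t : tupR, phi k (tshift t (hext s)) = - phi k t.
Proof.
move=> Hk kn0; have [q kq] := HH_quot Hk ord_max.
have [j qj] : exists j, q (lift ord_max j) != 0.
  apply: contrapT => nq; move/negP: kn0; apply; apply/eqP.
  have q0 i : tnth k i = tnth k ord_max.
    case: (unliftP ord_max i) => [j|] -> //.
    rewrite kq; case: (eqVneq (q (lift ord_max j)) 0) => [->|qj].
      by rewrite mulr0 addr0.
    by case: nq; exists j.
  have [+ _] := Hk; under eq_bigr do rewrite q0.
  rewrite sumr_const card_ord => /eqP; rewrite mulrn_eq0/= => /eqP k0.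
  by apply: eq_from_tnth => i; rewrite tnth_mktuple q0.
pose s l : R := if l == j then (2 * (q (lift ord_max j))%:~R)^-1 else 0.
exists s => t; rewrite phi_tshift.
rewrite (_ : _ / _ * _ = pi) /expi ?cospi ?sinpi; last first.
  have -> : \sum_i (tnth k i)%:~R * hext s i =
      \sum_l ((tnth k (lift ord_max l))%:~R - (tnth k ord_max)%:~R) * s l.
    rewrite (bigD1_ord ord_max)//= hext_max mulrN mulr_sumr -sumrN -big_split/=.
    by apply: eq_bigr => l _; rewrite hext_lift mulrBl addrC.
  rewrite (bigD1 j)//= big1 => [|l lj]; last by rewrite /s (negbTE lj) mulr0.
  rewrite addr0 /s eqxx kq intrD addrAC subrr add0r intrM.
  have q0 : (q (lift ord_max j))%:~R != 0 :> R by rewrite intr_eq0.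
  have D0 : d.+1%:R != 0 :> R by rewrite pnatr_eq0.
  by rewrite -[(_%:Z)%:~R]pmulrn; field; rewrite q0 nat1r.
by rewrite (_ : (_ +i* _)%C = -1) ?mulrN1//; apply/eqP; rewrite eq_complex/= oppr0 !eqxx.
Qed.

Lemma Cintegral_phi k : HH k -> Cintegral nu Omega (phi k) =
  if k == [tuple 0 | i < d.+1] then (Num.sqrt d.+1%:R)%:C%C else 0.
Proof.
move=> Hk; case: eqP => [->|/eqP kn0].
  rewrite /Cintegral; congr (_ +i* _)%C.
    rewrite (@eq_Rintegral _ _ _ _ _ (cst 1)) => [|t _]; last by rewrite phi0.
    by rewrite Rintegral_cst ?mul1r; [rewrite [nu _]RH_measure_OmegaH|exact: mOmega].
  rewrite (@eq_Rintegral _ _ _ _ _ (cst 0)) => [|t _]; last by rewrite phi0.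
  by rewrite Rintegral_cst ?mul0r//; exact: mOmega.
have [s ks] := phi_half_period Hk kn0.
rewrite /Cintegral.
rewrite (@Rintegral_RH_eq0 (fun t => complex.Re (phi k t)) s)
  ?(@Rintegral_RH_eq0 (fun t => complex.Im (phi k t)) s)//.
- exact: measurable_sin_angle.
- by move=> t; rewrite ler_norml sin_geN1 sin_le1.
- by move=> t a a0; rewrite phi_periodic.
- by move=> t; rewrite ks.
- exact: measurable_cos_angle.
- by move=> t; rewrite ler_norml cos_geN1 cos_le1.
- by move=> t a a0; rewrite phi_periodic.
- by move=> t; rewrite ks.
Qed.

End hexagon_integral.

(** * Complex-valued integrals and the cubature formula *)

Section complex_integral.
Context {disp : measure_display} {T : measurableType disp} {R : realType}.
Variables (mu : {measure set T -> \bar R}) (D : set T).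
Hypothesis mD : measurable D.
Implicit Types f g : T -> R[i].

Definition Cintegrable f :=
  mu.-integrable D (EFin \o (fun x => complex.Re (f x))) /\
  mu.-integrable D (EFin \o (fun x => complex.Im (f x))).

Lemma eq_Cintegral f g : (forall x, D x -> f x = g x) ->
  Cintegral mu D f = Cintegral mu D g.
Proof.
by move=> fg; congr (_ +i* _)%C; apply: eq_Rintegral => x; rewrite inE => /fg ->.
Qed.

Lemma CintegrableZ c f : Cintegrable f -> Cintegrable (fun x => c * f x).
Proof.
case: c => a b [fr fi]; split.
- rewrite (_ : _ \o _ = (fun x => a%:E * (complex.Re (f x))%:E -
    b%:E * (complex.Im (f x))%:E)%E); last by apply/funext => x /=; case: (f x).
  by apply: integrableB => //; exact: integrableZl.
- rewrite (_ : _ \o _ = (fun x => a%:E * (complex.Im (f x))%:E +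
    b%:E * (complex.Re (f x))%:E)%E); last by apply/funext => x /=; case: (f x).
  by apply: integrableD => //; exact: integrableZl.
Qed.

Lemma CintegralZ c f : Cintegrable f ->
  Cintegral mu D (fun x => c * f x) = c * Cintegral mu D f.
Proof.
case: c => a b [fr fi]; rewrite /Cintegral.
transitivity ((a * \int[mu]_(x in D) complex.Re (f x) -
    b * \int[mu]_(x in D) complex.Im (f x)) +i*
  (a * \int[mu]_(x in D) complex.Im (f x) +
    b * \int[mu]_(x in D) complex.Re (f x)))%C => //.
congr (_ +i* _)%C.
- rewrite -!RintegralZl// -RintegralB//; first last.
  + exact: (integrableZl mD b fi).
  + exact: (integrableZl mD a fr).
  by apply: eq_Rintegral => x _; case: (f x).
- rewrite -!RintegralZl// -RintegralD//; first last.
  + exact: (integrableZl mD b fr).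
  + exact: (integrableZl mD a fi).
  by apply: eq_Rintegral => x _; case: (f x).
Qed.

Lemma CintegralD f g : Cintegrable f -> Cintegrable g ->
  Cintegral mu D (fun x => f x + g x) = Cintegral mu D f + Cintegral mu D g.
Proof.
move=> [fr fi] [gr gi].
transitivity ((\int[mu]_(x in D) complex.Re (f x) +
    \int[mu]_(x in D) complex.Re (g x)) +i*
  (\int[mu]_(x in D) complex.Im (f x) +
    \int[mu]_(x in D) complex.Im (g x)))%C => //.
rewrite -!RintegralD//; congr (_ +i* _)%C;
  by apply: eq_Rintegral => x _; case: (f x); case: (g x).
Qed.

Lemma CintegrableD f g : Cintegrable f -> Cintegrable g ->
  Cintegrable (fun x => f x + g x).
Proof.
move=> [fr fi] [gr gi]; split.
- rewrite (_ : _ \o _ = (fun x => (complex.Re (f x))%:E + (complex.Re (g x))%:E)%E).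
    exact: integrableD.
  by apply/funext => x /=; case: (f x); case: (g x).
- rewrite (_ : _ \o _ = (fun x => (complex.Im (f x))%:E + (complex.Im (g x))%:E)%E).
    exact: integrableD.
  by apply/funext => x /=; case: (f x); case: (g x).
Qed.

(** Integrability of the sum is part of the statement because the induction
    step needs it. *)
Lemma Cintegral_sum (I : eqType) (s : seq I) (a : I -> R[i]) (g : I -> T -> R[i]) :
  (forall i, i \in s -> Cintegrable (g i)) ->
  Cintegrable (fun x => \sum_(i <- s) a i * g i x) /\
  Cintegral mu D (fun x => \sum_(i <- s) a i * g i x) =
  \sum_(i <- s) a i * Cintegral mu D (g i).
Proof.
elim: s => [_|i s IHs gs].
  under [X in Cintegrable X]eq_fun do rewrite big_nil.
  under [X in Cintegral _ _ X]eq_fun do rewrite big_nil.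
  split; first by split; exact: (integrable0 mu D).
  by rewrite big_nil /Cintegral/= Rintegral_cst// mul0r.
have [IH1 IH2] := IHs (fun j js => gs j (mem_behead (s := i :: s) js)).
have gi := CintegrableZ (a i) (gs i (mem_head i s)).
under [X in Cintegrable X]eq_fun do rewrite big_cons.
under [X in Cintegral _ _ X]eq_fun do rewrite big_cons.
split; first exact: CintegrableD.
by rewrite CintegralD// IH2 big_cons CintegralZ//; exact/gs/mem_head.
Qed.

End complex_integral.

Lemma Cintegrable_phi (R : realType) (d : nat) k :
  Cintegrable (RH_measure R d) (@OmegaH R d) (phi k).
Proof.
split; apply: bounded_integrable_OmegaH => [|t].
- exact: measurable_cos_angle.
- by rewrite ler_norml cos_geN1 cos_le1.
- exact: measurable_sin_angle.
- by rewrite ler_norml sin_geN1 sin_le1.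
Qed.

Theorem theorem3p18 (R : realType) (d n : nat) (hd : (1 <= d)%N) (hn : (1 <= n)%N)
    (f : d.+1.-tuple R -> R[i]) (hf : trigpoly (2 * n - 1)%N f) :
  ((Num.sqrt d.+1%:R)^-1)%:C%C * Cintegral (RH_measure R d) (@OmegaH R d) f =
  (d.+1%:R * n%:R ^+ d)^-1 *
    \sum_(j \in @Hstar d n) (weight R n j)%:C%C * f (node R n j).
Proof.
have [s [a [sH fE]]] := hf.
have fH := finite_Hstar d n.
rewrite (@eq_Cintegral _ _ _ _ _ _ (fun t => \sum_(k <- s) a k * phi k t)); last first.
  by move=> t [t0 _]; exact: fE.
have [_ ->] := @Cintegral_sum _ _ _ (RH_measure R d) _ (@measurable_OmegaH R d) _ s a
  (fun k => phi k) (fun k _ => Cintegrable_phi R k).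
have -> : \sum_(j \in @Hstar d n) (weight R n j)%:C%C * f (node R n j) =
    \sum_(k <- s) a k * \sum_(j \in @Hstar d n) (weight R n j)%:C%C * phi k (node R n j).
  transitivity (\sum_(j <- finmap.enum_fset (fset_set (@Hstar d n))) \sum_(k <- s)
      a k * ((weight R n j)%:C%C * phi k (node R n j))).
    rewrite fsbig_finite//; apply: eq_big_seq => j; rewrite in_fset_set// inE => -[Hj _].
    rewrite fE; last exact: RH_node.
    by rewrite mulr_sumr; apply: eq_bigr => k _; rewrite mulrCA.
  by rewrite exchange_big; apply: eq_bigr => k _; rewrite -mulr_sumr fsbig_finite.
rewrite !mulr_sumr; apply: eq_big_seq => k /sH Hk.
have Hk' : HH k by case: Hk.
rewrite Cintegral_phi// (cubature_phi R hd hn Hk).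
rewrite mulrCA [RHS]mulrCA; congr (_ * _).
case: eqP => _; last by rewrite !mulr0.
rewrite -rmorphM mulVf/=; last by rewrite gt_eqF// sqrtr_gt0 ltr0n.
by rewrite mulVf// mulf_neq0 ?expf_neq0 ?pnatr_eq0//; lia.
Qed.
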